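(* Let $n\in\mathbb{N}$, $(\kappa,k)\in\mathcal{L}_n$, $\kappa\in C_{-1}^{n-1}(0,+\infty)$, $f\in C_{-1}(0,+\infty)$, $\lambda\in\mathbb{R}$ and $\gamma_0\in\mathrm{Ker}(\mathbb{D}_{(k)})$. The unique solution $y\in C_{-1,(k)}^{(1)}(0,+\infty)$ to the initial-value problem $$\begin{cases}(\mathbb{D}_{(k)}y)(t)-\lambda y(t)=f(t), & t>0,\\ (F y)(t)=\gamma_0(t), & t>0,\end{cases}$$ is given by the expression $$y(t)=y_f(t)+y_{iv}(t)=(f*l_{\kappa,\lambda})(t)+\gamma_0(t)+\lambda(\gamma_0*l_{\kappa,\lambda})(t),$$ with $y_f=f*l_{\kappa,\lambda}$ and $y_{iv}=\gamma_0+\lambda(\gamma_0*l_{\kappa,\lambda})$, where $l_{\kappa,\lambda}$ is the convolution series $l_{\kappa,\lambda}(t)=\sum_{j=1}^{+\infty}\lambda^{j-1}\kappa^{<j>}(t)$. For the initial conditions in the form $\left(\frac{d^i}{dt^i}\,\mathbb{I}_{(k)}y\right)(0)=a_i$, $i=0,\dots,n-1$ (in place of $Fy=\gamma_0$), this solution can be represented as follows: $$y(t)=y_f(t)+y_{iv}(t)=(f*l_{\kappa,\lambda})(t)+\sum_{i=0}^{n-1}a_i\,\frac{d^{i}}{dt^{i}}\,l_{\kappa,\lambda}(t).$$ The function $y_f$ is the solution to the problem with the homogeneous initial condition ($\gamma_0(t)\equiv0$), whereas the function $y_{iv}$ is the solution to the problem with the homogeneous equation ($f(t)\equiv0$).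
   Context: All functions are functions of $t>0$. $(f*g)(t)=\int_0^t f(t-\tau)g(\tau)\,d\tau$ is the Laplace convolution, and $h_n(t)=t^{n-1}/(n-1)!$ for $n\in\mathbb{N}=\{1,2,\dots\}$. For $j\in\mathbb{N}$, $\kappa^{<j>}=\kappa*\cdots*\kappa$ ($j$ factors). $C_{-1}(0,+\infty)=\{f:\ f(t)=t^pf_1(t),\ t>0,\ p>-1,\ f_1\in C[0,+\infty)\}$. $C_{-1,0}(0,+\infty)=\{f:\ f(t)=t^pf_1(t),\ t>0,\ -1<p<0,\ f_1\in C[0,+\infty)\}$. For $m\in\mathbb{N}_0$, $C_{-1}^m(0,+\infty)=\{f\in C_{-1}(0,+\infty):\ f^{(m)}\in C_{-1}(0,+\infty)\}$. $\mathcal{L}_n$ is the set of pairs $(\kappa,k)$ with $\kappa\in C_{-1}(0,+\infty)$, $k\in C_{-1,0}(0,+\infty)$ and $(\kappa*k)(t)=h_n(t)$ for all $t>0$. $\mathbb{I}_{(k)}f=k*f$ and $\mathbb{I}_{(\kappa)}f=\kappa*f$ are general fractional integrals. The general fractional derivative of arbitrary order in the Riemann-Liouville sense is $(\mathbb{D}_{(k)}f)(t)=\frac{d^n}{dt^n}(k*f)(t)$, $t>0$, considered on its natural domain $C_{-1,(k)}^{(1)}(0,+\infty)=\{f\in C_{-1}(0,+\infty):\ \mathbb{D}_{(k)}f\in C_{-1}(0,+\infty)\}$. Its null space on this domain is $$\mathrm{Ker}(\mathbb{D}_{(k)})=\left\{\sum_{i=0}^{n-1}b_i\,\frac{d^{\,n-1-i}\kappa}{dt^{\,n-1-i}}:\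 b_0,\dots,b_{n-1}\in\mathbb{R}\right\}.$$ The projector operator of $\mathbb{D}_{(k)}$ is $$(Ff)(t)=f(t)-(\mathbb{I}_{(\kappa)}\mathbb{D}_{(k)}f)(t)=\sum_{i=0}^{n-1}\left(\frac{d^i}{dt^i}\,\mathbb{I}_{(k)}f\right)(0)\,\frac{d^{\,n-1-i}\kappa}{dt^{\,n-1-i}}(t),\quad t>0,\ f\in C_{-1,(k)}^{(1)}(0,+\infty).$$ The series defining $l_{\kappa,\lambda}$ (with $\lambda^0=1$) converges for all $t>0$ and defines a function in $C_{-1}(0,+\infty)$.
   Formalization: In the second formula a_i multiplies the derivative of l of order n-1-i, not i; for given a_i, existence is claimed if k is unbounded near 0 or some function of the domain attains the a_i; Ker is the null space of D_(k), not the displayed span. *)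

(* Defs.v *)
From HB Require Import structures.
From mathcomp Require Import all_boot all_order all_algebra.
From mathcomp Require Import all_classical all_reals all_analysis.

Set Implicit Arguments.
Unset Strict Implicit.
Unset Printing Implicit Defensive.

Import Order.TTheory GRing.Theory Num.Theory.
Import numFieldNormedType.Exports.

Local Open Scope classical_set_scope.
Local Open Scope ring_scope.

(* Functions on (0,+oo) are total functions R -> R of which only the values at
   t > 0 matter; correspondingly, equality of such functions is pointwise
   equality on t > 0, and the convolution integrates over the open interval. *)

Definition laplace_conv (R : realType) (f g : R -> R) (t : R) : R :=
  \int[lebesgue_measure]_(x in `]0, t[) (f (t - x) * g x).

(* h_n, for 0 < n. *)
Definition hfun (R : realType) (n : nat) (t : R) : R :=
  t ^+ n.-1 / (n.-1)`!%:R.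

Definition Cm1 (R : realType) (f : R -> R) : Prop :=
  exists (p : R) (f1 : R -> R),
    [/\ -1 < p, {within `[0, +oo[, continuous f1}
      & forall t, 0 < t -> f t = t `^ p * f1 t].

Definition Cm10 (R : realType) (f : R -> R) : Prop :=
  exists (p : R) (f1 : R -> R),
    [/\ -1 < p < 0, {within `[0, +oo[, continuous f1}
      & forall t, 0 < t -> f t = t `^ p * f1 t].

(* derive1n is total, so the existence of the derivatives of orders 1, ..., m at
   every t > 0 has to be stated separately. *)
Definition derivable_upto (R : realType) (m : nat) (f : R -> R) : Prop :=
  forall i, (i < m)%N -> forall t, 0 < t -> derivable (derive1n i f) t 1.

Definition Cm1_order (R : realType) (m : nat) (f : R -> R) : Prop :=
  [/\ Cm1 f, derivable_upto m f & Cm1 (derive1n m f)].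

(* The class L_n of pairs of kernels. *)
Definition kernel_pair (R : realType) (n : nat) (kappa k : R -> R) : Prop :=
  [/\ Cm1 kappa, Cm10 k
    & forall t, 0 < t -> laplace_conv kappa k t = hfun n t].

Definition GFI (R : realType) (k f : R -> R) : R -> R := laplace_conv k f.

Definition GFD (R : realType) (n : nat) (k f : R -> R) : R -> R :=
  derive1n n (GFI k f).

(* The natural domain C_{-1,(k)}^{(1)} of GFD n k. *)
Definition GFD_dom (R : realType) (n : nat) (k f : R -> R) : Prop :=
  [/\ Cm1 f, derivable_upto n (GFI k f) & Cm1 (GFD n k f)].

Definition GFD_ker (R : realType) (n : nat) (k g : R -> R) : Prop :=
  GFD_dom n k g /\ forall t, 0 < t -> GFD n k g t = 0.

Definition projector (R : realType) (n : nat) (kappa k f : R -> R) (t : R) : R :=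
  f t - GFI kappa (GFD n k f) t.

(* kappa^{<j>} for 0 < j. *)
Definition conv_pow (R : realType) (kappa : R -> R) (j : nat) : R -> R :=
  iter j.-1 (laplace_conv kappa) kappa.

Definition conv_series (R : realType) (kappa : R -> R) (lambda : R) (t : R) : R :=
  limn (fun N : nat =>
    \sum_(1 <= j < N.+1) lambda ^+ j.-1 * conv_pow kappa j t).

Definition GFD_equation (R : realType) (n : nat) (k : R -> R) (lambda : R)
    (f y : R -> R) : Prop :=
  forall t, 0 < t -> GFD n k y t - lambda * y t = f t.

(* (d^i/dt^i I_(k) y)(0) = a_i, the value at 0 being the limit at 0+. *)
Definition initial_values (R : realType) (n : nat) (k : R -> R)
    (a : 'I_n -> R) (y : R -> R) : Prop :=
  forall i : 'I_n, derive1n i (GFI k y) t @[t --> 0^'+] --> a i.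

Definition IVP_projector (R : realType) (n : nat) (kappa k : R -> R)
    (lambda : R) (f gamma0 y : R -> R) : Prop :=
  [/\ GFD_dom n k y, GFD_equation n k lambda f y
    & forall t, 0 < t -> projector n kappa k y t = gamma0 t].

Definition IVP_values (R : realType) (n : nat) (k : R -> R)
    (lambda : R) (f : R -> R) (a : 'I_n -> R) (y : R -> R) : Prop :=
  [/\ GFD_dom n k y, GFD_equation n k lambda f y & initial_values k a y].

Definition is_unique_solution (R : realType) (P : (R -> R) -> Prop)
    (y : R -> R) : Prop :=
  P y /\ forall z, P z -> forall t, 0 < t -> z t = y t.

(* Cm10 k does not force k to be singular at 0, and for a kernel k bounded near
   0 some initial values are attained by no function of the domain: for n = 2
   and kappa = k = 1 one has (I_(k) y)(0) = 0 for every y. *)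
Definition attainable (R : realType) (n : nat) (k : R -> R) (a : 'I_n -> R) : Prop :=
  exists2 u, GFD_dom n k u & initial_values k a u.

Definition y_f (R : realType) (kappa : R -> R) (lambda : R) (f : R -> R)
    (t : R) : R :=
  laplace_conv f (conv_series kappa lambda) t.

Definition y_iv (R : realType) (kappa : R -> R) (lambda : R) (gamma0 : R -> R)
    (t : R) : R :=
  gamma0 t + lambda * laplace_conv gamma0 (conv_series kappa lambda) t.

(* a_i goes with the derivative of order n-1-i, as it does in the expression of
   the projector, sum_i (d^i/dt^i I_(k) f)(0) kappa^(n-1-i). *)
Definition y_iv_values (R : realType) (n : nat) (kappa : R -> R) (lambda : R)
    (a : 'I_n -> R) (t : R) : R :=
  \sum_(i < n) a i * derive1n (n.-1 - i) (conv_series kappa lambda) t.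

(* Main.v *)
Require Import Defs.
From HB Require Import structures.
From mathcomp Require Import all_boot all_order all_algebra.
From mathcomp Require Import all_classical all_reals all_analysis.
From mathcomp Require Import measurable_realfun.
From mathcomp Require Import ring lra.

Import Order.TTheory GRing.Theory Num.Theory.
Import numFieldNormedType.Exports.

Local Open Scope classical_set_scope.
Local Open Scope ring_scope.

(** Write f * g for the Laplace convolution and l for the convolution series of
    kappa. On functions t^p f1(t) with p > -1 and f1 continuous, convolution is
    well defined, and it makes them a commutative associative algebra: the
    substitution x = t s shows that the product is again of this form
    ([laplace_conv_powR]), and associativity is Fubini's theorem ([convA]).
    Convolution with h_n is n-fold integration from 0 ([conv_hfun]).

    The series converges because its terms of high enough index are bounded near
    0, and because the weight exp(-c t), which convolution respects, makes the
    L1 norm of lambda kappa smaller than 1/2 when c is large; from then on the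
    terms decrease geometrically ([series_term_bound]). Summing the recursion
    for the terms gives l = kappa + lambda kappa * l ([conv_series_eq]): in the
    algebra with a unit adjoined, 1 + lambda l is the inverse of
    1 - lambda kappa. Hence z = g + lambda kappa * z holds if and only if
    z = g + lambda g * l ([volterra_unique], [volterra_exists]).

    As kappa * k = h_n, convolving y = gamma + kappa * phi with k gives
    k * y = k * gamma + h_n * phi, so that for gamma in the kernel of the
    derivative y = gamma + kappa * phi means that the derivative of y is phi and
    that the projection of y is gamma ([GFD_mild], [projector_mild]). With
    phi = f + lambda y the initial-value problem becomes the Volterra equation
    y = (gamma0 + kappa * f) + lambda kappa * y, whose solution is
    y_f + y_iv ([mild_solutionP]).

    For initial values a_i, Taylor's formula at 0 ([taylor_antider]) shows that
    the projection gamma of y satisfies k * gamma = sum_i a_i h_(i+1).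
    Convolution with kappa gives h_n * gamma = sum_i a_i (h_(i+1) * kappa), and
    a further convolution with l gives
    h_n * (l * gamma) = sum_i a_i (h_(i+1) * (l * kappa)). Differentiating these
    identities n times expresses gamma and l * gamma through the derivatives of
    kappa and of l * kappa, with no boundary terms at 0, and
    gamma + lambda l * gamma becomes sum_i a_i l^(n-1-i) ([y_iv_valuesE]).

    Conversely, if some function of the domain attains the values a_i, its
    projection is a gamma in the kernel attaining them as well, and the solution
    with this projection has the same initial values ([ivp_values_solution]).
    If k is unbounded near 0, then gamma = sum_i a_i kappa^(n-1-i) attains them
    ([unbounded_attainable]): this needs k * kappa^(m) = h_(n-m), which holds as
    long as kappa and its derivatives vanish at 0, and a nonzero limit c of one
    of them would give a Volterra equation c k = h_j - k * kappa^(m+1), j > 0,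
    whose solution k has a finite limit at 0 ([kernel_derive1n]). *)

(** * Functions t^p f1(t) with f1 continuous *)

Section NormalForm.
Context {R : realType}.
Implicit Types (f g : R -> R) (p q t : R).

(** Composition with the absolute value turns continuity on [0, +oo[ into continuity
    on the whole line, which spares all later arguments the subspace topology. *)
Lemma continuous_comp_norm (f : R -> R) :
  {within `[0, +oo[, continuous f} -> continuous (fun x : R => f `|x|).
Proof.
move=> /subspace_continuousP cf x.
have nx : `[0, +oo[%classic `|x| by rewrite /= in_itv /= normr_ge0.
apply: (cvg_comp (fun y : R => `|y|) f); last exact: (cf _ nx).
move=> A wA; have h : \forall y \near x, `[0, +oo[%classic `|y| -> A `|y|.
  exact: (@norm_continuous _ R x (fun z => `[0, +oo[%classic z -> A z)).
by apply: filterS h => y; apply; rewrite /= in_itv /= normr_ge0.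
Qed.

Lemma continuous_powR_gt0 p t : 0 < t -> {for t, continuous (fun x : R => x `^ p)}.
Proof.
move=> t0; apply/differentiable_continuous/derivable1_diffP.
by apply: derivable_powR; rewrite in_itv /= t0.
Qed.

Lemma continuous_norm_powR p : 0 <= p -> continuous (fun x : R => `|x| `^ p).
Proof.
rewrite le_eqVlt => /predU1P[<-|p0].
  by under eq_fun do rewrite powRr0; move=> x; exact: cvg_cst.
move=> x; have [->|x0] := eqVneq x 0; last first.
  apply: (cvg_comp (fun y : R => `|y|) (fun y => y `^ p)).
    exact: (@norm_continuous _ R).
  by apply: continuous_powR_gt0; rewrite normr_gt0.
rewrite /continuous_at normr0 powR0 ?gt_eqF//.
apply/cvgrPdist_lt => e e0; near=> y.
rewrite sub0r normrN ger0_norm ?powR_ge0//.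
have [->|y0] := eqVneq y 0; first by rewrite normr0 powR0 ?gt_eqF.
have -> : e = (e `^ p^-1) `^ p by rewrite -powRrM mulVf ?gt_eqF// powRr1// ltW.
apply: gt0_ltr_powR => //; rewrite ?nnegrE//.
  by rewrite powR_ge0.
near: y; apply/nbhs_ballP; exists (e `^ p^-1); first by rewrite /= powR_gt0.
by move=> y; rewrite /ball /= sub0r normrN.
Unshelve. all: by end_near. Qed.

(** The exponent may be lowered, since t^p f1(t) = t^q (t^(p - q) f1(t)) and t^(p - q)
    is continuous up to 0. This brings two functions to a common exponent. *)
Lemma Cm1_lower (q p : R) (f1 f : R -> R) : q <= p ->
  continuous f1 -> (forall t, 0 < t -> f t = t `^ p * f1 t) ->
  exists f2 : R -> R, continuous f2 /\ forall t, 0 < t -> f t = t `^ q * f2 t.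
Proof.
move=> qp cf1 fE; exists (fun t => `|t| `^ (p - q) * f1 t); split => [x|t t0].
  apply: cvgM; last exact: cf1.
  by apply: continuous_norm_powR; rewrite subr_ge0.
rewrite fE// gtr0_norm// mulrA -powRD; last by rewrite (gt_eqF t0) implybT.
by rewrite addrC subrK.
Qed.

(** Normal form: f1 is continuous on the whole line, and p is negative, so that t^p
    is decreasing. *)
Lemma Cm1P f : Cm1 f <-> exists p (f1 : R -> R),
  [/\ -1 < p < 0, continuous f1 & forall t, 0 < t -> f t = t `^ p * f1 t].
Proof.
split=> [[p [f1 [p1 cf1 fE]]]|[p [f1 [/andP[p1 _] cf1 fE]]]]; last first.
  by exists p, f1; split=> //; exact: continuous_subspaceT.
have qp : Num.min p (- 2^-1) <= p by rewrite ge_min lexx.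
have [t t0|f2 [cf2 fE2]] := Cm1_lower _ _ _ f qp (continuous_comp_norm _ cf1).
  by rewrite fE// gtr0_norm.
(* -1/2 is any number strictly between -1 and 0 *)
exists (Num.min p (- 2^-1)), f2; split=> //.
rewrite lt_min p1/= gt_min; apply/andP; split; first by lra.
by apply/orP; right; lra.
Qed.

Lemma Cm1_ext f g : (forall t, 0 < t -> f t = g t) -> Cm1 f -> Cm1 g.
Proof.
by move=> fg [p [f1 [p1 cf fE]]]; exists p, f1; split=> // t t0; rewrite -fg// fE.
Qed.

Lemma continuous_Cm1 f : continuous f -> Cm1 f.
Proof.
move=> cf; exists 0, f; split; [by rewrite ltrN10|exact: continuous_subspaceT|].
by move=> t _; rewrite powRr0 mul1r.
Qed.

Lemma Cm1_cst (c : R) : Cm1 (fun=> c).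
Proof. by apply: continuous_Cm1 => x; exact: cvg_cst. Qed.

Lemma Cm1Z (c : R) f : Cm1 f -> Cm1 (fun t => c * f t).
Proof.
move=> /Cm1P[p [f1 [/andP[p1 p0] cf fE]]]; apply/Cm1P.
exists p, (fun t => c * f1 t); split; [by rewrite p1| |].
  by move=> x; apply: cvgM; [exact: cvg_cst|exact: cf].
by move=> t t0; rewrite fE// mulrCA.
Qed.

Lemma Cm1D f g : Cm1 f -> Cm1 g -> Cm1 (fun t => f t + g t).
Proof.
move=> /Cm1P[p [f1 [/andP[p1 p0] cf fE]]] /Cm1P[q [g1 [/andP[q1 q0] cg gE]]].
have mp : Num.min p q <= p by rewrite ge_min lexx.
have mq : Num.min p q <= q by rewrite ge_min lexx orbT.
have [f2 [cf2 fE2]] := Cm1_lower _ _ _ _ mp cf fE.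
have [g2 [cg2 gE2]] := Cm1_lower _ _ _ _ mq cg gE.
apply/Cm1P; exists (Num.min p q), (fun t => f2 t + g2 t); split.
- by rewrite lt_min p1 q1 gt_min p0.
- by move=> x; apply: cvgD; [exact: cf2|exact: cg2].
- by move=> t t0; rewrite fE2// gE2// mulrDr.
Qed.

Lemma Cm1B f g : Cm1 f -> Cm1 g -> Cm1 (fun t => f t - g t).
Proof.
move=> cf cg; apply: (Cm1_ext (fun t => f t + -1 * g t)).
  by move=> t _; rewrite mulN1r.
by apply: Cm1D => //; exact: Cm1Z.
Qed.

Lemma Cm1_sum (I : Type) (s : seq I) (P : pred I) (F : I -> R -> R) :
  (forall i, P i -> Cm1 (F i)) -> Cm1 (fun t => \sum_(i <- s | P i) F i t).
Proof.
move=> cF; elim: s => [|i s IH].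
  by apply: (Cm1_ext (fun=> 0)) (Cm1_cst _) => t _; rewrite big_nil.
have [Pi|nPi] := boolP (P i).
  apply: (Cm1_ext (fun t => F i t + \sum_(i <- s | P i) F i t)).
    by move=> t _; rewrite big_cons Pi.
  by apply: Cm1D => //; exact: cF.
by apply: Cm1_ext IH => t _; rewrite big_cons (negbTE nPi).
Qed.

Lemma Cm1_norm f : Cm1 f -> Cm1 (fun t => `|f t|).
Proof.
move=> /Cm1P[p [f1 [/andP[p1 p0] cf fE]]]; apply/Cm1P.
exists p, (fun t => `|f1 t|); split; [by rewrite p1| |].
  by move=> x; apply: (continuous_comp (cf x)); exact: (@norm_continuous _ R).
by move=> t t0; rewrite fE// normrM ger0_norm// powR_ge0.
Qed.

Lemma Cm1_continuous f : Cm1 f -> forall t, 0 < t -> {for t, continuous f}.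
Proof.
move=> /Cm1P[p [f1 [_ cf fE]]] t t0.
have : {for t, continuous (fun t => t `^ p * f1 t)}.
  by apply: cvgM; [exact: continuous_powR_gt0|exact: cf].
move=> h; change (f x @[x --> t] --> f t); rewrite fE//.
apply: cvg_trans h; apply: near_eq_cvg; near=> x; rewrite fE//.
by near: x; exact: lt_nbhsr.
Unshelve. all: by end_near. Qed.

Lemma continuous_bounded_itv f (T : R) : continuous f ->
  exists2 M, 0 < M & forall x, `|x| <= T -> `|f x| <= M.
Proof.
move=> cf.
have [M [_ MB]] : bounded_set (f @` `[- T, T]).
  apply: compact_bounded; apply: continuous_compact.
    exact: continuous_subspaceT.
  exact: segment_compact.
exists (Num.max M 0 + 1) => [|x xT].
  by rewrite ltr_wpDl// le_max lexx orbT.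
apply: (MB (Num.max M 0 + 1)).
  by rewrite (@le_lt_trans _ _ (Num.max M 0)) ?le_max ?lexx// ltrDl.
by exists x => //=; rewrite in_itv /= -ler_norml.
Qed.

Lemma Cm1_bound f p (f1 : R -> R) T : continuous f1 ->
  (forall t, 0 < t -> f t = t `^ p * f1 t) ->
  exists2 M, 0 < M & forall t, 0 < t <= T -> `|f t| <= M * t `^ p.
Proof.
move=> cf1 fE; have [M M0 MB] := continuous_bounded_itv f1 T cf1.
exists M => // t /andP[t0 tT].
rewrite fE// normrM ger0_norm ?powR_ge0// mulrC ler_wpM2r ?powR_ge0//.
by apply: MB; rewrite gtr0_norm.
Qed.

End NormalForm.

(** * Affine changes of variable in Lebesgue integrals *)

Section AffineChange.
Context {R : realType}.
Notation mu := (@lebesgue_measure R).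
Local Open Scope ereal_scope.

Let measurable_affine (a b : R) :
  measurable_fun [set: R] (fun x : R => (a * x + b)%R).
Proof.
apply: measurable_funD; last exact: measurable_cst.
by apply: measurable_funM; [exact: measurable_cst|exact: measurable_id].
Qed.

(** Both sides are measures in A, and they agree on half-open intervals. *)
Lemma lebesgue_measure_affine (a b : R) (A : set R) : (a != 0)%R ->
  measurable A ->
  mu A = (`|a|%R)%:E * mu ((fun x => (a * x + b)%R) @^-1` A).
Proof.
move=> a0 mA.
pose nu := mscale (NngNum (normr_ge0 a))
  (pushforward mu (fun x : R => (a * x + b)%R : measurableTypeR R)).
have mphi : measurable_fun [set: measurableTypeR R]
  (fun x : R => (a * x + b)%R : measurableTypeR R) by exact: measurable_affine.
rewrite (@lebesgue_measure_unique _ (nu mphi))// => X [[u v] _ <-] /=.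
rewrite -[RHS]/((`|a|%R)%:E * mu ((fun x => (a * x + b)%R) @^-1` `]u, v])).
have [a_gt0|a_lt0|/esym/eqP] := ltgtP 0%R a; last by rewrite (negbTE a0).
  have -> : (fun x => (a * x + b)%R) @^-1` `]u, v] =
      `]((u - b) / a)%R, ((v - b) / a)%R]%classic.
    apply/seteqP; split => x /=; rewrite !in_itv/=.
      by rewrite ltr_pdivrMr// ler_pdivlMr// ltrBlDr lerBrDr mulrC.
    by rewrite ltr_pdivrMr// ler_pdivlMr// ltrBlDr lerBrDr mulrC.
  rewrite !lebesgue_measure_itv/= !lte_fin ltr_pM2r ?invr_gt0// ltrD2r.
  case: ifPn => _; last by rewrite mule0.
  rewrite -!EFinB -EFinM gtr0_norm//; congr EFin.
  by field.
have -> : (fun x => (a * x + b)%R) @^-1` `]u, v] =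
    `[((v - b) / a)%R, ((u - b) / a)%R[%classic.
  apply/seteqP; split => x /=; rewrite !in_itv/=.
    by rewrite ltr_ndivlMr// ler_ndivrMr// ltrBlDr lerBrDr mulrC andbC.
  by rewrite ltr_ndivlMr// ler_ndivrMr// ltrBlDr lerBrDr mulrC andbC.
rewrite !lebesgue_measure_itv/= !lte_fin ltr_nM2r ?invr_lt0// ltrD2r.
case: ifPn => _; last by rewrite mule0.
rewrite -!EFinB -EFinM ltr0_norm//; congr EFin.
by field; rewrite lt_eqF.
Qed.

Lemma ge0_integral_affine (a b : R) (F : R -> \bar R) : (a != 0)%R ->
  measurable_fun [set: R] F -> (forall x, 0 <= F x) ->
  \int[mu]_x F x = (`|a|%R)%:E * \int[mu]_x F (a * x + b)%R.
Proof.
move=> a0 mF F0.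
have mphi : measurable_fun [set: measurableTypeR R]
  (fun x : R => (a * x + b)%R : measurableTypeR R) by exact: measurable_affine.
pose nu := mscale (NngNum (normr_ge0 a))
  (pushforward mu (fun x : R => (a * x + b)%R : measurableTypeR R)).
rewrite (eq_measure_integral (nu mphi)); last first.
  by move=> A mA _; rewrite /= (lebesgue_measure_affine a b).
by rewrite ge0_integral_mscale// ge0_integral_pushforward.
Qed.

Lemma integrable_affine (a b : R) (F : R -> R) : (a != 0)%R ->
  mu.-integrable setT (EFin \o F) ->
  mu.-integrable setT (fun x => (F (a * x + b)%R)%:E).
Proof.
move=> a0 /integrableP[mF iF]; apply/integrableP; split.
  by apply: (measurableT_comp mF); exact: measurable_affine.
move: iF; rewrite (ge0_integral_affine a b)//; last exact: measurableT_comp.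
rewrite [X in _ * X](_ : _ = \int[mu]_x `|(F (a * x + b)%R)%:E|)//.
case: (\int[mu]_x _)%E => [r _|/=|//]; first exact: ltry.
by rewrite gt0_muley ?lte_fin ?normr_gt0 ?ltxx.
Qed.

Lemma Rintegral_affine (a b : R) (F : R -> R) : (a != 0)%R ->
  mu.-integrable setT (EFin \o F) ->
  (\int[mu]_x F x = `|a| * \int[mu]_x F (a * x + b))%R.
Proof.
move=> a0 iF; have iFa := integrable_affine _ b _ a0 iF.
have mF := measurable_int _ iF.
have mp := measurable_funepos mF; have mn := measurable_funeneg mF.
rewrite /Rintegral; suff -> : \int[mu]_x (F x)%:E =
    (`|a|%R)%:E * \int[mu]_x (F (a * x + b)%R)%:E.
  by rewrite fineM//; exact: integrable_fin_num iFa.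
rewrite [LHS]integralE [in RHS]integralE.
rewrite (ge0_integral_affine a b _ a0 mp)// (ge0_integral_affine a b _ a0 mn)//.
rewrite [RHS]muleBr//.
  by congr (_ * _ - _ * _); apply: eq_integral => x _; rewrite ?funeposE ?funenegE.
by rewrite fin_num_adde_defl// fin_numN (integrable_neg_fin_num _ iFa).
Qed.

End AffineChange.

(** * Integrability of powers near 0 *)

Section PowerIntegrability.
Context {R : realType}.
Notation mu := (@lebesgue_measure R).
Implicit Types (f g : R -> R) (p q t : R).

(** A bound uniform in a, with which a can tend to 0 by monotone convergence. *)
Lemma integral_powR_le p (a T : R) : -1 < p -> 0 < a -> a < T ->
  (\int[mu]_(x in `[a, T]) (x `^ p)%:E <= (T `^ (p + 1) / (p + 1))%:E)%E.
Proof.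
move=> p1 a0 aT; have p10 : 0 < p + 1 by lra.
have dF (x : R) : 0 < x -> is_derive x 1 (fun y : R => y `^ (p + 1) / (p + 1)) (x `^ p).
  move=> x0; have h := is_derive1_powR (p + 1) x0.
  have -> : x `^ p = (p + 1)^-1 *: ((p + 1) * x `^ (p + 1 - 1)).
    by rewrite addrK /GRing.scale /= mulKf ?gt_eqF.
  rewrite (_ : (fun y : R => _) = (p + 1)^-1 \*: (fun y : R => y `^ (p + 1))).
    exact: is_deriveZ.
  by apply/funext => y /=; rewrite /GRing.scale /= mulrC.
have cF (x : R) : 0 < x -> {for x, continuous (fun y : R => y `^ (p + 1) / (p + 1))}.
  move=> x0; apply/differentiable_continuous/derivable1_diffP.
  by have [] := dF x x0.
rewrite (@continuous_FTC2 _ _ (fun y => y `^ (p + 1) / (p + 1)))//.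
- rewrite -EFinB lee_fin lerBlDr lerDl.
  by rewrite divr_ge0 ?powR_ge0// ltW.
- apply: continuous_in_subspaceT => x; rewrite inE /= in_itv /= => /andP[ax _].
  by apply: continuous_powR_gt0; exact: lt_le_trans ax.
- split.
  + move=> x; rewrite in_itv /= => /andP[ax _].
    by have [] := dF x (lt_trans a0 ax).
  + by apply: cvg_at_right_filter; exact: cF.
  + by apply: cvg_at_left_filter; apply: cF; exact: lt_trans aT.
- move=> x; rewrite in_itv /= => /andP[ax _].
  by rewrite derive1E; have [_ ->] := dF x (lt_trans a0 ax).
Qed.

Lemma integrable_powR p (T : R) : -1 < p -> 0 < T ->
  mu.-integrable `]0, T[ (EFin \o (fun x : R => x `^ p)).
Proof.
move=> p1 T0.
have -> : `]0, T[%classic = \bigcup_n `[T / n.+2%:R, T[%classic.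
  apply/seteqP; split => x /=.
    rewrite in_itv/= => /andP[x0 xT].
    have [n nx] : exists n : nat, T / x <= n%:R.
      by exists (Num.bound (T / x)); rewrite ltW// archi_boundP// divr_ge0// ltW.
    exists n => //=; rewrite in_itv /= xT andbT ler_pdivrMr// mulrC -ler_pdivrMr//.
    by rewrite (le_trans nx)// ler_nat leqW// leqnSn.
  move=> [n _] /=; rewrite !in_itv/= => /andP[+ ->]; rewrite andbT.
  by apply: lt_le_trans; rewrite divr_gt0.
have mB : measurable (\bigcup_n `[T / n.+2%:R, T[%classic : set R).
  by apply: bigcup_measurable => n _; exact: measurable_itv.
apply/integrableP; split.
  by apply/measurable_EFinP; apply: measurable_funTS; exact: measurable_powR.
apply: (@le_lt_trans _ _ (T `^ (p + 1) / (p + 1))%:E); last exact: ltry.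
under eq_integral do rewrite /= ger0_norm ?powR_ge0//.
have nd : {homo (fun n => `[T / n.+2%:R, T[%classic) : n m / (n <= m)%N >-> (n <= m)%O}.
  move=> n m nm; apply/subsetPset => x /=; rewrite !in_itv /= => /andP[+ ->].
  rewrite andbT; apply: le_trans; rewrite ler_pM2l// lef_pV2 ?posrE// ler_nat.
  by rewrite !ltnS.
have mp (D : set R) : measurable_fun D (fun x : R => (x `^ p)%:E).
  by apply/measurable_EFinP; apply: measurable_funTS; exact: measurable_powR.
pose F n : set R := `[T / n.+2%:R, T[%classic.
have h : (\int[mu]_(x in F n) (x `^ p)%:E @[n --> \oo] -->
    \int[mu]_(x in \bigcup_n F n) (x `^ p)%:E)%E.
  apply: ge0_nondecreasing_set_cvg_integral; [exact: nd| | |] => n.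
  - exact: measurable_itv.
  - exact: mp.
  - by move=> x _; rewrite lee_fin powR_ge0.
rewrite -(cvg_lim _ h)//.
apply: lime_le; first exact: (cvgP _ h).
apply: nearW => n.
apply: le_trans (integral_powR_le p (T / n.+2%:R) T p1 _ _).
- apply: ge0_subset_integral => //; [exact: measurable_itv|exact: mp| |].
  + by move=> x _; rewrite lee_fin powR_ge0.
  + by move=> x; rewrite /F /= !in_itv /= => /andP[-> /ltW ->].
- by rewrite divr_gt0.
- by rewrite ltr_pdivrMr// ltr_pMr// ltr1n.
Qed.

End PowerIntegrability.

(** * Existence of the convolution integral *)

Section ConvolutionIntegrability.
Context {R : realType}.
Notation mu := (@lebesgue_measure R).
Implicit Types (f g : R -> R) (p q t : R).

Lemma integrable_patch (I : interval R) f :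
  mu.-integrable [set` I] (EFin \o f) -> mu.-integrable setT (EFin \o (f \_ [set` I])).
Proof.
move/integrable_mkcond => /(_ (measurable_itv _)).
by rewrite restrict_EFin.
Qed.

(** With zero extensions, [laplace_conv] is the convolution on the whole line, whose
    domain of integration does not depend on t ([laplace_convE]); translations,
    reflections and Fubini's theorem then apply directly. *)
Definition ext0 (f : R -> R) : R -> R := f \_ `]0, +oo[.

Lemma ext0_gt0 f x : 0 < x -> ext0 f x = f x.
Proof. by move=> x0; rewrite /ext0 patchE mem_set//= in_itv /= x0. Qed.

Lemma ext0_le0 f x : x <= 0 -> ext0 f x = 0.
Proof.
move=> x0; rewrite /ext0 patchE memNset//= in_itv /= andbT.
by apply/negP; rewrite -leNgt.
Qed.

Lemma ext0_convE f g t x :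
  ext0 f (t - x) * ext0 g x = ((fun x => f (t - x) * g x) \_ `]0, t[) x.
Proof.
rewrite patchE; case: ifPn => [|].
  by rewrite inE /= in_itv /= => /andP[x0 xt]; rewrite !ext0_gt0// subr_gt0.
rewrite notin_setE /= in_itv /= => /negP; rewrite negb_and -!leNgt => /orP[x0|tx].
  by rewrite (ext0_le0 g)// mulr0.
by rewrite ext0_le0 ?mul0r// subr_le0.
Qed.

Lemma laplace_convE f g t :
  laplace_conv f g t = \int[mu]_x (ext0 f (t - x) * ext0 g x).
Proof.
rewrite /laplace_conv Rintegral_mkcond.
by apply: eq_Rintegral => x _; rewrite ext0_convE.
Qed.

Lemma measurable_ext0 f : Cm1 f -> measurable_fun [set: R] (ext0 f).
Proof.
move=> cf; have mI : measurable (`]0, +oo[%classic : set R) by exact: measurable_itv.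
apply/(measurable_restrictT f mI).
apply: open_continuous_measurable_fun; first by rewrite set_itvE; exact: open_gt.
by move=> x; rewrite inE /= in_itv /= andbT => x0; exact: (Cm1_continuous f cf x x0).
Qed.

Lemma ler_powR_nonpos p (a b : R) : p <= 0 -> 0 < a -> a <= b -> b `^ p <= a `^ p.
Proof.
move=> p0 a0 ab; rewrite -[p]opprK powRN [leRHS]powRN.
have b0 := lt_le_trans a0 ab.
rewrite lef_pV2 ?posrE ?powR_gt0//.
by rewrite ge0_ler_powR ?nnegrE ?oppr_ge0// ltW.
Qed.

(** One of x and t - x is at least t / 2, and both powers decrease; this separates
    the singularities at 0 and at t. *)
Lemma powR_conv_le p q t x : -1 < p < 0 -> -1 < q < 0 -> 0 < x < t ->
  (t - x) `^ p * x `^ q <=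
  (t / 2) `^ p * x `^ q + (t / 2) `^ q * (t - x) `^ p.
Proof.
move=> /andP[_ /ltW p0] /andP[_ /ltW q0] /andP[x0 xt].
have t0 := lt_trans x0 xt.
have [xt2|tx2] := leP x (t / 2).
  rewrite ler_wpDr ?mulr_ge0 ?powR_ge0// ler_wpM2r ?powR_ge0//.
  by apply: ler_powR_nonpos; [by []|lra|lra].
rewrite ler_wpDl ?mulr_ge0 ?powR_ge0// mulrC ler_wpM2r ?powR_ge0//.
by apply: ler_powR_nonpos; [by []|lra|lra].
Qed.

Lemma integrable_powR_rev p t : -1 < p -> 0 < t ->
  mu.-integrable `]0, t[ (EFin \o (fun x : R => (t - x) `^ p)).
Proof.
move=> p1 t0; have iP := integrable_powR p t p1 t0.
apply/integrable_mkcond; first exact: measurable_itv.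
rewrite restrict_EFin; have {}iP := integrable_patch _ _ iP.
have N10 : -1 != 0 :> R by rewrite oppr_eq0 oner_eq0.
have := integrable_affine _ t _ N10 iP; congr (integrable _ _ _).
apply/funext => x /=; congr EFin; rewrite !patchE.
rewrite (_ : (-1 * x + t \in `]0, t[%classic) = (x \in `]0, t[%classic)).
  by rewrite mulN1r addrC.
by apply/idP/idP; rewrite !inE /= !in_itv /= => /andP[h1 h2]; apply/andP; split; lra.
Qed.

Lemma integrable_conv f g t : Cm1 f -> Cm1 g ->
  mu.-integrable setT (EFin \o (fun x => ext0 f (t - x) * ext0 g x)).
Proof.
move=> cf cg; have mf := measurable_ext0 _ cf; have mg := measurable_ext0 _ cg.
have [t0|t0] := leP t 0.
  rewrite (_ : EFin \o _ = cst 0%E); first exact: integrable0.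
  apply/funext => x /=; rewrite ext0_convE set_itv_ge ?patch_set0//.
  by rewrite bnd_simp -leNgt.
have mtx : measurable_fun [set: R] (fun x : R => t - x).
  by apply: measurable_funB; [exact: measurable_cst|exact: measurable_id].
have mh : measurable_fun [set: R] (fun x => ext0 f (t - x) * ext0 g x).
  by apply: measurable_funM => //; exact: (measurableT_comp mf).
move: cf cg => /Cm1P[p [f1 [pP cf1 fE]]] /Cm1P[q [g1 [qP cg1 gE]]].
have [M M0 fM] := Cm1_bound _ _ _ t cf1 fE.
have [N N0 gN] := Cm1_bound _ _ _ t cg1 gE.
have [/andP[p1 _] /andP[q1 _]] := (pP, qP).
rewrite (_ : EFin \o _ = EFin \o ((fun x => f (t - x) * g x) \_ `]0, t[)).
  have mI : measurable (`]0, t[%classic : set R) by exact: measurable_itv.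
  apply: integrable_patch.
  pose h (x : R) := (M * N * (t / 2) `^ p) * x `^ q +
    (M * N * (t / 2) `^ q) * (t - x) `^ p.
  have ih : mu.-integrable `]0, t[ (EFin \o h).
    rewrite (_ : EFin \o h = (fun x => (M * N * (t / 2) `^ p)%:E * (x `^ q)%:E) \+
        (fun x => (M * N * (t / 2) `^ q)%:E * ((t - x) `^ p)%:E))%E//.
    apply: integrableD; first exact: measurable_itv.
      apply: integrableZl; first exact: measurable_itv.
      exact: integrable_powR.
    apply: integrableZl; first exact: measurable_itv.
    exact: integrable_powR_rev.
  apply: le_integrable ih.
  - exact: measurable_itv.
  - apply/measurable_EFinP.
    apply/(measurable_restrictT _ mI).
    apply: eq_measurable_fun mh => x _; exact: ext0_convE.
  - move=> x; rewrite /= in_itv /= => /andP[x0 xt]; rewrite lee_fin.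
    apply: le_trans (ler_norm _); rewrite normrM.
    apply: (@le_trans _ _ ((M * (t - x) `^ p) * (N * x `^ q))).
      apply: ler_pM => //.
        by apply: fM; rewrite subr_gt0 xt gerBl ltW.
      by apply: gN; rewrite x0 ltW.
    have := powR_conv_le p q t x pP qP.
    rewrite x0 xt => /(_ isT) le_pq.
    rewrite /h mulrACA -!(mulrA (M * N)) -mulrDr.
    by rewrite ler_pM2l// mulr_gt0.
by apply/funext => x /=; rewrite ext0_convE.
Qed.
End ConvolutionIntegrability.

(** * Convolution of functions with power singularities *)

Section ConvolutionPower.
Context {R : realType}.
Notation mu := (@lebesgue_measure R).
Implicit Types (f g h : R -> R) (p q t : R).

Lemma integrable_conv_itv f g t : Cm1 f -> Cm1 g ->
  mu.-integrable `]0, t[ (EFin \o (fun x => f (t - x) * g x)).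
Proof.
move=> cf cg; apply/integrable_mkcond; first exact: measurable_itv.
rewrite restrict_EFin; have := integrable_conv f g t cf cg.
by congr (integrable _ _ _); apply/funext => x /=; rewrite ext0_convE.
Qed.

Lemma Cm1_powR p : -1 < p -> Cm1 (fun x : R => x `^ p).
Proof.
move=> p1; exists p, (fun=> 1); split=> // [|t _]; last by rewrite mulr1.
by apply: continuous_subspaceT => x; exact: cvg_cst.
Qed.

(** Substituting x = t s in the convolution integral takes out the factor
    t^(p + q + 1) and leaves the integral over ]0, 1[ of
    (1 - s)^p s^q f1(t (1 - s)) g1(t s), which is continuous in t by dominated
    convergence, a multiple of (1 - s)^p s^q being the dominating function. *)
Lemma laplace_conv_powR p q (f1 g1 f g : R -> R) : -1 < p -> -1 < q ->
  continuous f1 -> continuous g1 ->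
  (forall t, 0 < t -> f t = t `^ p * f1 t) ->
  (forall t, 0 < t -> g t = t `^ q * g1 t) ->
  exists G : R -> R, continuous G /\
    forall t, 0 < t -> laplace_conv f g t = t `^ (p + q + 1) * G t.
Proof.
move=> p1 q1 cf1 cg1 fE gE.
(* the integrand after the substitution, y being the former t *)
pose K (y s : R) := (1 - s) `^ p * s `^ q * (f1 (y * (1 - s)) * g1 (y * s)).
have mK y : measurable_fun [set: R] (K y).
  have m1s : measurable_fun [set: R] (fun s : R => 1 - s).
    by apply: measurable_funB; [exact: measurable_cst|exact: measurable_id].
  have my1s : measurable_fun [set: R] (fun s : R => y * (1 - s)).
    by apply: measurable_funM => //; exact: measurable_cst.
  have mys : measurable_fun [set: R] (fun s : R => y * s).
    by apply: measurable_funM; [exact: measurable_cst|exact: measurable_id].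
  apply: measurable_funM.
    apply: measurable_funM; last exact: measurable_powR.
    exact: (measurableT_comp (@measurable_powR R p) m1s).
  apply: measurable_funM.
    exact: (measurableT_comp (continuous_measurable_fun cf1) my1s).
  exact: (measurableT_comp (continuous_measurable_fun cg1) mys).
have iB := integrable_conv_itv _ _ 1 (Cm1_powR p p1) (Cm1_powR q q1).
have Kdom (T : R) : exists2 C, 0 <= C & forall y s, `|y| <= T ->
    `]0, 1[%classic s -> `|K y s| <= C * ((1 - s) `^ p * s `^ q).
  have [M M0 fM] := continuous_bounded_itv _ T cf1.
  have [N N0 gN] := continuous_bounded_itv _ T cg1.
  exists (M * N) => [|y s yT]; first by rewrite mulr_ge0 ?ltW.
  rewrite /= in_itv /= => /andP[s0 s1].
  have le01 (u : R) : 0 <= u <= 1 -> `|y * u| <= T.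
    move=> /andP[u0 u1]; rewrite normrM (ger0_norm u0).
    by apply: le_trans yT; rewrite ler_piMr.
  rewrite /K normrM mulrC (ger0_norm (mulr_ge0 (powR_ge0 _ _) (powR_ge0 _ _))).
  rewrite ler_wpM2r ?mulr_ge0 ?powR_ge0// normrM ler_pM//.
    by apply: fM; apply: le01; apply/andP; split; lra.
  by apply: gN; apply: le01; rewrite (ltW s0) ltW.
have iKdom C : mu.-integrable `]0, 1[ (EFin \o (fun s : R => C * ((1 - s) `^ p * s `^ q))).
  rewrite (_ : EFin \o _ = (fun s => C%:E * ((1 - s) `^ p * s `^ q)%:E)%E)//.
  by apply: integrableZl => //; exact: measurable_itv.
have iK y : mu.-integrable `]0, 1[ (EFin \o K y).
  have [C _ KC] := Kdom `|y|.
  apply: le_integrable (iKdom C).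
  - exact: measurable_itv.
  - by apply/measurable_EFinP; apply: measurable_funTS; exact: mK.
  - by move=> s s01; rewrite lee_fin; apply: le_trans (ler_norm _); apply: KC.
exists (fun y => \int[mu]_(s in `]0, 1[) K y s); split.
  move=> y; have [C _ KC] := Kdom (`|y| + 1).
  have := @continuity_under_integral R _ _ mu K `]0, 1[ (measurable_itv _)
    (- (`|y| + 1)) (`|y| + 1) (fun x _ => iK x) _ _ (iKdom C).
  apply.
  - apply: aeW => s _ x _ ; apply: cvgM; first exact: cvg_cst.
    apply: cvgM.
      apply: (cvg_comp (fun x => x * (1 - s)) f1); last exact: cf1.
      by apply: cvgM; [exact: cvg_id|exact: cvg_cst].
    apply: (cvg_comp (fun x => x * s) g1); last exact: cg1.
    by apply: cvgM; [exact: cvg_id|exact: cvg_cst].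
  - move=> x /= xT; apply: aeW => s s01; apply: KC => //.
    by move: xT; rewrite in_itv /= -ltr_norml => /ltW.
  - by rewrite inE /= in_itv /= -ltr_norml ltrDl.
move=> t t0.
have cf : Cm1 f by exists p, f1; split=> //; exact: continuous_subspaceT.
have cg : Cm1 g by exists q, g1; split=> //; exact: continuous_subspaceT.
rewrite laplace_convE (Rintegral_affine t 0) ?gt_eqF//; last exact: integrable_conv.
rewrite gtr0_norm// [in RHS]Rintegral_mkcond.
rewrite powRD ?(gt_eqF t0) ?implybT// powRr1 ?ltW// [in RHS](mulrC _ t) -mulrA.
congr (t * _); rewrite -RintegralZl//; last first.
  exact/integrable_patch/iK.
apply: eq_Rintegral => s _; rewrite addr0 patchE; case: ifPn.
  rewrite inE /= in_itv /= => /andP[s0 s1].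
  rewrite !ext0_gt0 ?mulr_gt0//; last by rewrite subr_gt0 gtr_pMr.
  have -> : t - t * s = t * (1 - s) by ring.
  rewrite fE ?gE ?mulr_gt0 ?subr_gt0// /K !powRM ?ltW ?subr_gt0//.
  rewrite powRD ?(gt_eqF t0) ?implybT//.
  ring.
rewrite notin_setE /= in_itv /= => /negP; rewrite negb_and -!leNgt mulr0 => /orP[s0|s1].
  by rewrite (ext0_le0 g) ?mulr0// pmulr_rle0.
by rewrite (ext0_le0 f) ?mul0r// subr_le0 ler_pMr.
Qed.

Lemma Cm1_conv f g : Cm1 f -> Cm1 g -> Cm1 (laplace_conv f g).
Proof.
move=> /Cm1P[p [f1 [/andP[p1 _] cf1 fE]]] /Cm1P[q [g1 [/andP[q1 _] cg1 gE]]].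
have [G [cG GE]] := laplace_conv_powR p q f1 g1 f g p1 q1 cf1 cg1 fE gE.
exists (p + q + 1), G; split=> //; first by lra.
exact: continuous_subspaceT.
Qed.

End ConvolutionPower.

(** * The convolution algebra *)

Section ConvolutionAlgebra.
Context {R : realType}.
Notation mu := (@lebesgue_measure R).
Implicit Types (f g h : R -> R) (p q t : R).

Lemma eq_conv f f' g g' t : (forall s, 0 < s -> f s = f' s) ->
  (forall s, 0 < s -> g s = g' s) -> laplace_conv f g t = laplace_conv f' g' t.
Proof.
move=> ff gg; apply: eq_Rintegral => x; rewrite inE /= in_itv /= => /andP[x0 xt].
by rewrite ff ?subr_gt0// gg.
Qed.

Lemma convC f g t : Cm1 f -> Cm1 g -> laplace_conv f g t = laplace_conv g f t.
Proof.
move=> cf cg; have N10 : -1 != 0 :> R by rewrite oppr_eq0 oner_eq0.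
rewrite !laplace_convE (Rintegral_affine (-1) t)//; last exact: integrable_conv.
rewrite normrN1 mul1r; apply: eq_Rintegral => x _.
rewrite mulrC; congr (ext0 g _ * ext0 f _); ring.
Qed.

Lemma convDl f g h t : Cm1 f -> Cm1 g -> Cm1 h ->
  laplace_conv (fun x => f x + g x) h t = laplace_conv f h t + laplace_conv g h t.
Proof.
move=> cf cg ch; rewrite /laplace_conv.
under eq_Rintegral do rewrite mulrDl.
by rewrite RintegralD//; exact: integrable_conv_itv.
Qed.

Lemma convZl (c : R) f g t : Cm1 f -> Cm1 g ->
  laplace_conv (fun x => c * f x) g t = c * laplace_conv f g t.
Proof.
move=> cf cg; rewrite /laplace_conv.
under eq_Rintegral do rewrite -mulrA.
by rewrite RintegralZl//; exact: integrable_conv_itv.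
Qed.

Lemma convDr f g h t : Cm1 f -> Cm1 g -> Cm1 h ->
  laplace_conv f (fun x => g x + h x) t = laplace_conv f g t + laplace_conv f h t.
Proof.
move=> cf cg ch; rewrite convC//; last exact: Cm1D.
by rewrite convDl// (convC g)// (convC h).
Qed.

Lemma convZr (c : R) f g t : Cm1 f -> Cm1 g ->
  laplace_conv f (fun x => c * g x) t = c * laplace_conv f g t.
Proof.
by move=> cf cg; rewrite convC ?convZl ?(convC g)//; exact: Cm1Z.
Qed.

Lemma laplace_conv0r f g t : (forall s, 0 < s -> g s = 0) -> laplace_conv f g t = 0.
Proof.
move=> g0; rewrite /laplace_conv; under eq_Rintegral => x.
  rewrite inE /= in_itv /= => /andP[x0 _]; rewrite g0// mulr0; over.
by rewrite Rintegral_cst ?mul0r//.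
Qed.

Lemma convBr f g h t : Cm1 f -> Cm1 g -> Cm1 h ->
  laplace_conv f (fun x => g x - h x) t = laplace_conv f g t - laplace_conv f h t.
Proof.
move=> cf cg ch.
have -> : (fun x => g x - h x) = (fun x => g x + -1 * h x).
  by apply/funext => x; rewrite mulN1r.
by rewrite convDr ?convZr ?mulN1r//; exact: Cm1Z.
Qed.

Lemma conv_sumr f (n : nat) (G : nat -> R -> R) t : Cm1 f ->
  (forall i, (i < n)%N -> Cm1 (G i)) ->
  laplace_conv f (fun x => \sum_(i < n) G i x) t =
  \sum_(i < n) laplace_conv f (G i) t.
Proof.
move=> cf; elim: n => [|n IH] cG.
  by rewrite big_ord0; apply: laplace_conv0r => s _; rewrite big_ord0.
rewrite big_ord_recr /= -IH => [|i ni]; last by apply: cG; rewrite ltnS ltnW.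
rewrite -convDr//; last 2 first.
- by apply: Cm1_sum => i _; apply: cG; rewrite ltnS ltnW.
- exact: cG.
by apply: eq_conv => // s _; rewrite big_ord_recr.
Qed.

Lemma ext0_norm f x : ext0 (fun x => `|f x|) x = `|ext0 f x|.
Proof.
have [x0|x0] := ltP 0 x; first by rewrite !ext0_gt0.
by rewrite !ext0_le0// normr0.
Qed.

Lemma ext0_conv f g t : ext0 (laplace_conv f g) t = laplace_conv f g t.
Proof.
have [t0|t0] := ltP 0 t; first by rewrite ext0_gt0.
rewrite ext0_le0// /laplace_conv set_itv_ge ?Rintegral_set0//.
by rewrite bnd_simp -leNgt.
Qed.

Lemma EFin_conv f g t : Cm1 f -> Cm1 g ->
  (laplace_conv f g t)%:E = (\int[mu]_x (ext0 f (t - x) * ext0 g x)%:E)%E.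
Proof.
move=> cf cg; rewrite laplace_convE /Rintegral fineK//.
exact: (integrable_fin_num _ (integrable_conv f g t cf cg)).
Qed.

(** Both sides integrate f(t - z) g(z - x) h(x) over the plane, after a translation of
    the inner variable on the left. Absolute integrability is the existence at t of
    the convolution of |f| with |g| * |h|. *)
Lemma convA f g h t : Cm1 f -> Cm1 g -> Cm1 h ->
  laplace_conv (laplace_conv f g) h t = laplace_conv f (laplace_conv g h) t.
Proof.
move=> cf cg ch; have cfg := Cm1_conv _ _ cf cg; have cgh := Cm1_conv _ _ cg ch.
pose K (z : R * R) : \bar R :=
  (ext0 f (t - z.2) * (ext0 g (z.2 - z.1) * ext0 h z.1))%:E.
have mK : measurable_fun setT K.
  apply/measurable_EFinP; apply: measurable_funM.
    apply: (measurableT_comp (measurable_ext0 _ cf)).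
    by apply: measurable_funB; [exact: measurable_cst|exact: measurable_snd].
  apply: measurable_funM; last first.
    exact: (measurableT_comp (measurable_ext0 _ ch) measurable_fst).
  apply: (measurableT_comp (measurable_ext0 _ cg)).
  by apply: measurable_funB; [exact: measurable_snd|exact: measurable_fst].
have ig z := integrable_conv _ _ z cg ch.
have inner2 z : (\int[mu]_x K (x, z) =
    (ext0 f (t - z) * ext0 (laplace_conv g h) z)%:E)%E.
  by rewrite ext0_conv EFinM EFin_conv// -integralZl//; exact: ig.
have inner1 x : (\int[mu]_z K (x, z) =
    (ext0 (laplace_conv f g) (t - x) * ext0 h x)%:E)%E.
  have iF := integrable_conv f g (t - x) cf cg.
  have : (laplace_conv f g (t - x))%:E =
      (\int[mu]_z (ext0 f (t - z) * ext0 g (z - x))%:E)%E.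
    rewrite laplace_convE (Rintegral_affine 1 (- x)) ?oner_eq0//.
    have iF1 := integrable_affine 1 (- x) _ (oner_neq0 _) iF.
    rewrite normr1 mul1r /Rintegral fineK; last exact: (integrable_fin_num _ iF1).
    apply: eq_integral => z _; congr EFin; congr (ext0 f _ * ext0 g _); ring.
  rewrite ext0_conv EFinM => ->.
  rewrite muleC -integralZl//; last first.
    have := integrable_affine 1 (- x) _ (oner_neq0 _) iF.
    congr (integrable _ _ _); apply/funext => z /=; congr EFin.
    congr (ext0 f _ * ext0 g _); ring.
  by apply: eq_integral => z _; rewrite /K /= -EFinM; congr EFin; ring.
have iK : (mu \x mu)%E.-integrable setT K.
  apply/integrable21ltyP => //.
  have := integrable_conv _ _ t (Cm1_norm _ cf)
    (Cm1_conv _ _ (Cm1_norm _ cg) (Cm1_norm _ ch)).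
  move=> /integrableP[_]; apply: le_lt_trans.
  rewrite le_eqVlt; apply/orP; left; apply/eqP; apply: eq_integral => z _.
  rewrite /= !ext0_norm ext0_conv.
  have cg' := Cm1_norm _ cg; have ch' := Cm1_norm _ ch.
  have c0 : 0 <= laplace_conv (fun x => `|g x|) (fun x => `|h x|) z.
    by apply: Rintegral_ge0 => y _; rewrite mulr_ge0.
  rewrite (ger0_norm (mulr_ge0 (normr_ge0 _) c0)).
  rewrite EFinM EFin_conv// -integralZl//; last exact: integrable_conv.
  apply: eq_integral => x _; rewrite /K /= -EFinM; congr EFin.
  by rewrite !ext0_norm !normrM.
have := Fubini iK.
under eq_integral do rewrite inner1.
under [RHS]eq_integral do rewrite inner2.
by rewrite -!EFin_conv// => -[].
Qed.

End ConvolutionAlgebra.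

(** * Convolution with 1 and the fundamental theorem of calculus *)

Section Antiderivative.
Context {R : realType}.
Notation mu := (@lebesgue_measure R).
Implicit Types (f g h u : R -> R) (p q t : R).

Definition antider (f : R -> R) : R -> R := laplace_conv (fun=> 1) f.

Lemma Cm1_antider f : Cm1 f -> Cm1 (antider f).
Proof. by move=> cf; apply: Cm1_conv => //; exact: Cm1_cst. Qed.

Lemma antiderE f t : Cm1 f -> antider f t = \int[mu]_(x in `]0, t]) f x.
Proof.
move=> cf; rewrite -Rintegral_itv_bndo_bndc.
  by apply: eq_Rintegral => x _; rewrite mul1r.
have := integrable_conv_itv _ _ t (Cm1_cst 1) cf.
by congr (integrable _ _ _); apply/funext => x /=; rewrite mul1r.
Qed.

Lemma integrable_itv0c f t : Cm1 f -> mu.-integrable `]0, t] (EFin \o f).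
Proof.
move=> cf; have := integrable_conv_itv _ _ (t + 1) (Cm1_cst 1) cf.
rewrite (_ : EFin \o _ = EFin \o f); last first.
  by apply/funext => x /=; rewrite mul1r.
apply: integrableS => // x /=; rewrite !in_itv /= => /andP[-> xt].
by rewrite (le_lt_trans xt)// ltrDl.
Qed.

Lemma le_antider f s t : Cm1 f -> (forall x, 0 < x -> 0 <= f x) -> s <= t ->
  antider f s <= antider f t.
Proof.
move=> cf f0 st; rewrite !antiderE// /Rintegral.
have i1 (x : R) := integrable_itv0c f x cf.
apply: fine_le.
- exact: integrable_fin_num (i1 s).
- exact: integrable_fin_num (i1 t).
apply: ge0_subset_integral => //.
- exact: measurable_int (i1 t).
- by move=> x /=; rewrite in_itv /= lee_fin => /andP[x0 _]; exact: f0.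
- by move=> x /=; rewrite !in_itv /= => /andP[-> /le_trans ->].
Qed.

Lemma is_derive_antider f t : Cm1 f -> 0 < t -> is_derive t 1 (antider f) (f t).
Proof.
move=> cf t0.
have i1 := integrable_itv0c f (t + 1) cf.
have tt1 : t < t + 1 by rewrite ltrDl.
have b0t : (BRight 0 < BRight t)%O by rewrite bnd_simp.
have [dF dE] := @continuous_FTC1 R f (BRight 0) t (t + 1) tt1 i1 b0t
  (Cm1_continuous f cf t t0).
rewrite (_ : antider f = fun x =>
    \int[mu]_(t in [set` Interval (BRight 0) (BRight x)]) f t).
  by rewrite derive1E in dE; exact: (DeriveDef dF dE).
by apply/funext => x; exact: antiderE.
Qed.

(** With exponents 0 for the constant 1 and p > -1 for f, [laplace_conv_powR] gives
    the positive exponent p + 1. *)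
Lemma antider_cvg0 f : Cm1 f -> antider f t @[t --> 0^'+] --> 0.
Proof.
move=> /Cm1P[p [f1 [/andP[p1 _] cf fE]]].
have c1 : continuous (fun _ : R => 1 : R) by move=> x; exact: cvg_cst.
have E1 (t : R) : 0 < t -> 1 = t `^ 0 * 1 by rewrite powRr0 mul1r.
have [G [cG GE]] := laplace_conv_powR 0 p _ f1 (fun=> 1) f (ltrN10 _) p1 c1 cf E1 fE.
have p10 : 0 < 0 + p + 1 by lra.
have h : t `^ (0 + p + 1) * G t @[t --> 0^'+] --> 0 * G 0.
  by apply: cvgM; [exact: (powR_cvg0 p10)|apply: cvg_at_right_filter; exact: cG].
rewrite mul0r in h; apply: cvg_trans h; apply: near_eq_cvg; near=> t.
by rewrite -(GE t).
Unshelve. all: by end_near. Qed.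

Lemma derive0_cst u : (forall t, 0 < t -> is_derive t 1 u 0) ->
  forall s t, 0 < s -> 0 < t -> u s = u t.
Proof.
move=> du.
suff lt_eq s t : 0 < s -> s < t -> u s = u t.
  move=> s t s0 t0; have [st|ts|->//] := ltgtP s t; first exact: lt_eq.
  by apply/esym/lt_eq.
move=> s0 st.
have [||c _] := @MVT R u (fun=> 0) s t st.
- by move=> x; rewrite in_itv /= => /andP[sx _]; apply: du; exact: lt_trans sx.
- apply: continuous_in_subspaceT => x; rewrite inE /= in_itv /= => /andP[sx _].
  apply/differentiable_continuous/derivable1_diffP.
  by have [] := du x (lt_le_trans s0 sx).
- by rewrite mul0r => /eqP; rewrite subr_eq0 => /eqP ->.
Qed.

(** The difference of u and the antiderivative has derivative 0 on ]0, +oo[; its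
    constant value c is the limit of u at 0+. *)
Lemma antiderivative_antider f u : Cm1 f -> (forall t, 0 < t -> is_derive t 1 u (f t)) ->
  exists c, forall t, 0 < t -> u t = c + antider f t.
Proof.
move=> cf du; exists (u 1 - antider f 1) => t t0.
have d0 (s : R) : 0 < s -> is_derive s 1 (u \- antider f) 0.
  move=> s0; rewrite -(subrr (f s)).
  by apply: is_deriveB; [exact: du|exact: is_derive_antider].
have /= := derive0_cst _ d0 1 t ltr01 t0.
by move=> ->; rewrite subrK.
Qed.

Lemma antiderivative_lim f u (c : R) : Cm1 f ->
  (forall t, 0 < t -> is_derive t 1 u (f t)) ->
  u t @[t --> 0^'+] --> c -> forall t, 0 < t -> u t = c + antider f t.
Proof.
move=> cf du uc; have [d ud] := antiderivative_antider f u cf du.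
suff -> : c = d by [].
have h : d + antider f t @[t --> 0^'+] --> d + 0.
  by apply: cvgD; [exact: cvg_cst|exact: antider_cvg0].
rewrite addr0 in h; have h2 : u t @[t --> 0^'+] --> d.
  by apply: cvg_trans h; apply: near_eq_cvg; near=> t; rewrite ud.
exact: (cvg_unique _ uc h2).
Unshelve. all: by end_near. Qed.

End Antiderivative.

(** * Tools for convergence of series *)

Section SeriesTools.
Context {R : realType}.
Notation mu := (@lebesgue_measure R).
Implicit Types (f g h u : R -> R) (p q t : R).

Lemma norm_conv_le f g g' t : Cm1 f -> Cm1 g -> Cm1 g' ->
  (forall x, 0 < x < t -> `|g x| <= g' x) ->
  `|laplace_conv f g t| <= laplace_conv (fun x => `|f x|) g' t.
Proof.
move=> cf cg cg' gg'.
have i1 := integrable_conv_itv _ _ t cf cg.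
apply: (le_trans (le_normr_Rintegral _ i1)) => //.
apply: le_Rintegral => //; last 2 first.
- exact: integrable_conv_itv (Cm1_norm _ cf) cg'.
- move=> x /=; rewrite in_itv /= => xt.
  by rewrite normrM ler_wpM2l// gg'.
have := integrable_conv_itv _ _ t (Cm1_norm _ cf) (Cm1_norm _ cg).
by congr (integrable _ _ _); apply/funext => x /=; rewrite normrM.
Qed.

Lemma Cm1M_continuous f g : Cm1 f -> continuous g -> Cm1 (fun t => f t * g t).
Proof.
move=> /Cm1P[p [f1 [pP cf fE]]] cg; apply/Cm1P.
exists p, (fun t => f1 t * g t); split=> // [x|t t0].
  by apply: cvgM; [exact: cf|exact: cg].
by rewrite fE// mulrA.
Qed.

Lemma continuous_expRM (c : R) : continuous (fun x : R => expR (c * x)).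
Proof.
move=> x; apply: (cvg_comp (fun x => c * x) expR); last exact: continuous_expR.
by apply: cvgM; [exact: cvg_cst|exact: cvg_id].
Qed.

(** The integrals over ]0, T[ of |f(x)| exp(- m x), m a natural number, tend to 0 by
    dominated convergence. *)
Lemma weighted_small f T (e : R) : Cm1 f -> 0 < e -> exists2 c : R, 0 <= c &
  antider (fun x => `|f x| * expR (- c * x)) T <= e.
Proof.
move=> cf e0.
have cw (n : nat) : Cm1 (fun x => `|f x| * expR (- n%:R * x)).
  apply: Cm1M_continuous; [exact: Cm1_norm|exact: continuous_expRM].
have iw n := integrable_conv_itv _ _ T (Cm1_cst 1) (cw n).
pose D : set R := `]0, T[%classic.
have cvg0 : (\int[mu]_(x in D) (1 * (`|f x| * expR (- n%:R * x)))%:E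
    @[n --> \oo] --> \int[mu]_(x in D) (cst 0%E x))%E.
  have := @dominated_convergence _ _ _ mu `]0, T[%classic (measurable_itv _)
    (fun n x => (1 * (`|f x| * expR (- n%:R * x)))%:E) (cst 0%E)
    (fun x => (1 * (`|f x| * expR (- 0%:R * x)))%:E).
  case => //.
  - by move=> n; exact: measurable_int (iw n).
  - apply: aeW => x; rewrite /= in_itv /= => /andP[x0 _].
    apply/fine_cvgP; split; first exact: nearW.
    have eE n : 1 * (`|f x| * expR (- n%:R * x)) = geometric `|f x| (expR (- x)) n.
      by rewrite /geometric /= mul1r mulNr -mulrN expRM_natl.
    rewrite /comp /=; under eq_fun do rewrite eE.
    apply: cvg_geometric.
    by rewrite ger0_norm ?expR_ge0// expR_lt1 oppr_lt0.
  - exact: iw 0%N.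
  - apply: aeW => x n; rewrite /= in_itv /= => /andP[x0 _].
    rewrite lee_fin !mul1r ger0_norm ?mulr_ge0 ?expR_ge0// ler_wpM2l//.
    by rewrite ler_expR !mulNr lerN2 ler_pM2r// ler_nat.
have : (fun n : nat => antider (fun x => `|f x| * expR (- n%:R * x)) T) @ \oo --> (0 : R).
  by move: cvg0; rewrite integral0 => /fine_cvg.
move=> /cvgrPdist_le/(_ e e0)[n _ /(_ n (leqnn n))]; rewrite sub0r normrN => h.
by exists n%:R => //; apply: le_trans h; exact: ler_norm.
Qed.

(** Weierstrass' test for geometric bounds that are uniform on bounded sets, with the
    rate at which the partial sums converge. *)
Lemma M_test (U : nat -> R -> R) : (forall k, continuous (U k)) ->
  (forall T, exists C, forall k x, `|x| <= T -> `|U k x| <= C * 2^-1 ^+ k) ->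
  exists S : R -> R, continuous S /\
    forall T, exists C, forall n x, `|x| <= T ->
      `|S x - \sum_(k < n) U k x| <= C * 2^-1 ^+ n.
Proof.
move=> cU Ub.
have partial T C : (forall k x, `|x| <= T -> `|U k x| <= C * 2^-1 ^+ k) ->
    forall n m x, `|x| <= T ->
    `|\sum_(k < n + m) U k x - \sum_(k < n) U k x| <=
      2 * C * 2^-1 ^+ n - 2 * C * 2^-1 ^+ (n + m).
  move=> UC n m x xT; elim: m => [|m IH]; first by rewrite addn0 !subrr normr0.
  rewrite addnS big_ord_recr /= addrAC.
  apply: le_trans (ler_normD _ _) _; apply: le_trans (lerD IH (UC _ _ xT)) _.
  by rewrite exprS; lra.
have cvgU x : cvgn (fun n => \sum_(k < n) U k x).
  have [C UC] := Ub `|x|.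
  have C0 : 0 <= C.
    by have := UC 0%N x (lexx _); rewrite expr0 mulr1; apply: le_trans.
  rewrite (_ : (fun n => _) = series (fun k => U k x)); last first.
    by apply/funext => n; rewrite /series /= big_mkord.
  have z1 : `|2^-1 : R| < 1 by rewrite ger0_norm// invf_lt1// ltr1n.
  apply: normed_cvg; apply: series_le_cvg (is_cvg_geometric_series (a := C) z1) => k.
  - exact: normr_ge0.
  - by rewrite /geometric /= mulr_ge0 ?exprn_ge0.
  - exact: UC.
exists (fun x => limn (fun n => \sum_(k < n) U k x)).
have tail T : exists C, forall n x, `|x| <= T ->
      `|limn (fun n => \sum_(k < n) U k x) - \sum_(k < n) U k x| <= C * 2^-1 ^+ n.
  have [C UC] := Ub T; exists (2 * C) => n x xT.
  have C0 : 0 <= C.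
    by have := UC 0%N x xT; rewrite expr0 mulr1; apply: le_trans.
  have h : `|\sum_(k < m) U k x - \sum_(k < n) U k x| @[m --> \oo] -->
      `|limn (fun n => \sum_(k < n) U k x) - \sum_(k < n) U k x|.
    apply: cvg_norm; apply: cvgB; [exact: cvgU|exact: cvg_cst].
  rewrite -(cvg_lim _ h)//; apply: limr_le; first exact: cvgP h.
  exists n => // m /= nm; rewrite -(subnKC nm).
  apply: le_trans (partial T C UC n (m - n)%N x xT) _.
  by rewrite gerBl mulr_ge0// ?exprn_ge0// mulr_ge0.
split; last exact: tail.
move=> x; apply/cvgrPdist_lt => e e0.
have [C tailC] := tail (`|x| + 1).
have e30 : 0 < e / 3 by rewrite divr_gt0.
have [n Cn] : exists n, C * 2^-1 ^+ n < e / 3.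
  have z1 : `|2^-1 : R| < 1 by rewrite ger0_norm// invf_lt1// ltr1n.
  have /cvgrPdist_lt/(_ _ e30)[n _ /(_ n (leqnn n))] := cvg_geometric C z1.
  by rewrite sub0r normrN => /ltr_normlW h; exists n.
have cS : continuous (fun x => \sum_(k < n) U k x).
  elim: n {Cn} => [|m IH] y.
    by under eq_fun do rewrite big_ord0; exact: cvg_cst.
  under eq_fun do rewrite big_ord_recr.
  by apply: cvgD; [exact: IH|exact: cU].
have /cvgrPdist_lt/(_ _ e30) near_x := cS x.
near=> y.
have yT : `|y| <= `|x| + 1.
  have : `|x - y| <= 1.
    near: y; have /cvgrPdist_le/(_ _ ltr01) := @cvg_id _ (nbhs x).
    exact.
  have := ler_dist_dist y x; rewrite distrC => h1 h2.
  by have := le_trans (ler_norm _) (le_trans h1 h2); rewrite lerBlDl.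
have xT : `|x| <= `|x| + 1 by rewrite lerDl.
have := le_lt_trans (tailC n y yT) Cn; have := le_lt_trans (tailC n x xT) Cn.
have : `|\sum_(k < n) U k x - \sum_(k < n) U k y| < e / 3 by near: y.
rewrite !ltr_norml; move: (limn _) (limn _) (\sum_(k < n) _) (\sum_(k < n) _) => a b c d.
by move=> /andP[? ?] /andP[? ?] /andP[? ?]; apply/andP; split; lra.
Unshelve. all: by end_near. Qed.

End SeriesTools.

(** * The convolution series *)

Section Resolvent.
Context {R : realType}.
Notation mu := (@lebesgue_measure R).
Implicit Types (f g h u kappa : R -> R) (p q t lambda : R).

(** Numbered from 0, so that the index counts the convolutions with kappa. *)
Definition series_term (kappa : R -> R) (lambda : R) (m : nat) (t : R) : R :=
  lambda ^+ m * conv_pow kappa m.+1 t.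

Lemma Cm1_conv_pow kappa m : Cm1 kappa -> Cm1 (conv_pow kappa m.+1).
Proof. by move=> ck; elim: m => [//|m IH]; exact: Cm1_conv. Qed.

Lemma Cm1_series_term kappa lambda m : Cm1 kappa -> Cm1 (series_term kappa lambda m).
Proof. by move=> ck; apply/Cm1Z/Cm1_conv_pow. Qed.

Lemma series_termS kappa lambda m t : Cm1 kappa ->
  series_term kappa lambda m.+1 t =
  lambda * laplace_conv kappa (series_term kappa lambda m) t.
Proof.
move=> ck; rewrite /series_term convZr//; last exact: Cm1_conv_pow.
by rewrite mulrA exprS.
Qed.

(** Each convolution with kappa adds p + 1 > 0 to the exponent. *)
Lemma conv_pow_powR p (k1 kappa : R -> R) m : -1 < p -> continuous k1 ->
  (forall t, 0 < t -> kappa t = t `^ p * k1 t) ->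
  exists G : R -> R, continuous G /\
    forall t, 0 < t -> conv_pow kappa m.+1 t = t `^ (m.+1%:R * (p + 1) - 1) * G t.
Proof.
move=> p1 ck kE; elim: m => [|m [G [cG GE]]].
  by exists k1; split=> // t t0; rewrite mul1r addrK; exact: kE.
have pm : -1 < m.+1%:R * (p + 1) - 1.
  by rewrite ltrDr mulr_gt0// -ltrBlDr sub0r.
have [H [cH HE]] := laplace_conv_powR _ _ _ _ _ _ p1 pm ck cG kE GE.
exists H; split=> // t t0.
rewrite -[conv_pow _ _ _]/(laplace_conv kappa (conv_pow kappa m.+1) t) HE//.
by congr (_ `^ _ * _); rewrite [in RHS]mulrS; ring.
Qed.

(** If the term of index N is bounded, induction gives the bound
    B 2^(-k) exp(c t) for the term of index N + k: the factor exp(c t) can be taken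
    out of the convolution with kappa, at the price of the weight exp(- c x) on kappa,
    and c makes the weighted integral of |lambda kappa| at most 1/2. *)
Lemma series_term_bound kappa lambda (N : nat) (T B : R) : Cm1 kappa ->
  (forall t, 0 < t <= T -> `|series_term kappa lambda N t| <= B) ->
  exists C, forall k t, 0 < t <= T ->
    `|series_term kappa lambda (N + k) t| <= C * 2^-1 ^+ k.
Proof.
move=> ck wB.
(* the weighted integral of |kappa| that leaves at most 1/2 after multiplication by
   |lambda|, also when lambda = 0 *)
have e0 : 0 < (2 * (`|lambda| + 1))^-1 by rewrite invr_gt0 mulr_gt0// ltr_wpDl.
have [c c0 small] := weighted_small kappa T _ ck e0.
have cpsi : Cm1 (fun x => `|kappa x| * expR (- c * x)).
  by apply: Cm1M_continuous; [exact: Cm1_norm|exact: continuous_expRM].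
have main k t : 0 < t <= T ->
    `|series_term kappa lambda (N + k) t| <= `|B| * 2^-1 ^+ k * expR (c * t).
  elim: k t => [|k IH] t /andP[t0 tT].
    rewrite addn0 expr0 mulr1; apply: le_trans (wB t _) _; first by rewrite t0.
    apply: le_trans (ler_norm _) _; rewrite ler_peMr// -expR0 ler_expR.
    by rewrite mulr_ge0// ltW.
  rewrite addnS series_termS// normrM.
  pose A := `|B| * 2^-1 ^+ k.
  have A0 : 0 <= A by rewrite mulr_ge0// exprn_ge0.
  have cA : Cm1 (fun x => A * expR (c * x)).
    exact/Cm1Z/continuous_Cm1/continuous_expRM.
  have le1 : `|laplace_conv kappa (series_term kappa lambda (N + k)) t| <=
      laplace_conv (fun x => `|kappa x|) (fun x => A * expR (c * x)) t.
    apply: norm_conv_le => //; first exact: Cm1_series_term.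
    move=> x /andP[x0 xt]; apply: IH; rewrite x0 /=.
    by rewrite (le_trans (ltW xt)).
  have le2 : laplace_conv (fun x => `|kappa x|) (fun x => A * expR (c * x)) t =
      A * expR (c * t) * antider (fun x => `|kappa x| * expR (- c * x)) t.
    rewrite /antider (convC _ _ _ (Cm1_cst 1) cpsi).
    have -> : A * expR (c * t) * laplace_conv
        (fun x => `|kappa x| * expR (- c * x)) (fun=> 1) t =
        laplace_conv (fun x => A * expR (c * t) * (`|kappa x| * expR (- c * x)))
          (fun=> 1) t by rewrite (convZl _ _ _ _ cpsi (Cm1_cst 1)).
    apply: eq_Rintegral => x _; rewrite mulr1.
    (* split the weight between the bound at t and the kernel at t - x *)
    have -> : c * x = c * t + - c * (t - x) by ring.
    by rewrite expRD; ring.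
  have le3 : antider (fun x => `|kappa x| * expR (- c * x)) t <=
      (2 * (`|lambda| + 1))^-1.
    by apply: le_trans small; apply: le_antider => // x _; rewrite mulr_ge0// expR_ge0.
  rewrite exprS; apply: (@le_trans _ _
    (`|lambda| * (A * expR (c * t) * (2 * (`|lambda| + 1))^-1))).
    rewrite ler_wpM2l//; apply: (le_trans le1); rewrite le2 ler_wpM2l//.
    by rewrite mulr_ge0// expR_ge0.
  have -> : `|B| * (2^-1 * 2^-1 ^+ k) * expR (c * t) =
     (A * expR (c * t)) * 2^-1 by rewrite /A; ring.
  rewrite mulrCA ler_wpM2l//; first by rewrite mulr_ge0// expR_ge0.
  have l1 : 0 < `|lambda| + 1 by rewrite ltr_wpDl.
  by rewrite invfM mulrCA ler_piMr// ler_pdivrMr// mul1r lerDl.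
exists (`|B| * expR (c * T)) => k t /andP[t0 tT].
apply: le_trans (main k t _) _; first by rewrite t0.
rewrite -mulrA (mulrC (_ ^+ _)) mulrA ler_wpM2r ?exprn_ge0//.
by rewrite ler_wpM2l// ler_expR ler_wpM2l.
Qed.

Lemma exists_exponent_gt0 p : -1 < p -> exists N : nat, forall m, (N <= m)%N ->
  0 < m.+1%:R * (p + 1) - 1.
Proof.
move=> p1; have p10 : 0 < p + 1 by lra.
exists (Num.bound (p + 1)^-1) => m Nm; rewrite subr_gt0 -ltr_pdivrMr// mul1r.
apply: lt_le_trans (archi_boundP _) _; first by rewrite invr_ge0 ltW.
by rewrite ler_nat (leq_trans Nm).
Qed.

(** The first terms may be unbounded near 0. From the index N on the exponents are
    positive, the terms extend continuously by 0, and [M_test] applies. *)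
Lemma series_tail kappa lambda : Cm1 kappa -> exists N : nat, exists S : R -> R,
  continuous S /\ forall T, exists C, forall n t, 0 < t <= T ->
  `|S t - \sum_(k < n) series_term kappa lambda (N + k) t| <= C * 2^-1 ^+ n.
Proof.
move=> ck; have /Cm1P[p [k1 [/andP[p1 _] ck1 kE]]] := ck.
have [N Npos] := exists_exponent_gt0 p p1.
have /choice[G GP] := fun m => conv_pow_powR p k1 kappa m p1 ck1 kE.
pose e m : R := m.+1%:R * (p + 1) - 1.
pose U k (x : R) := lambda ^+ (N + k) * (`|x| `^ e (N + k)%N * G (N + k)%N `|x|).
have e0 k : 0 < e (N + k)%N by apply: Npos; exact: leq_addr.
have UE k t : 0 < t -> U k t = series_term kappa lambda (N + k) t.
  by move=> t0; rewrite /U /series_term gtr0_norm// (GP _).2.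
have cU k : continuous (U k).
  move=> x; apply: cvgM; first exact: cvg_cst.
  apply: cvgM; first exact: continuous_norm_powR (ltW (e0 k)) _.
  apply: (cvg_comp (fun y : R => `|y|) (G (N + k)%N)); last exact: (GP _).1.
  exact: (@norm_continuous _ R).
have Ub T : exists C, forall k x, `|x| <= T -> `|U k x| <= C * 2^-1 ^+ k.
  have [B B0 UB] := continuous_bounded_itv _ T (cU 0%N).
  have [|C wC] := series_term_bound kappa lambda N T B ck.
    by move=> t /andP[t0 tT]; rewrite -[X in series_term _ _ X]addn0 -UE// UB// gtr0_norm.
  exists `|C| => k x xT; have [->|x0] := eqVneq x 0.
    by rewrite /U normr0 powR0 ?gt_eqF// mul0r mulr0 normr0 mulr_ge0// exprn_ge0.
  have -> : U k x = U k `|x| by rewrite /U normr_id.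
  rewrite UE ?normr_gt0//; apply: le_trans (wC _ _ _) _.
    by rewrite normr_gt0 x0.
  by rewrite ler_wpM2r ?exprn_ge0// ler_norm.
have [S [cS SP]] := M_test U cU Ub.
exists N, S; split=> // T; have [C SC] := SP T.
exists C => n t /andP[t0 tT].
have -> : \sum_(k < n) series_term kappa lambda (N + k) t = \sum_(k < n) U k t.
  by apply: eq_bigr => k _; rewrite UE.
by apply: SC; rewrite gtr0_norm.
Qed.

Lemma eq0_geometric (x C : R) : (forall n, `|x| <= C * 2^-1 ^+ n) -> x = 0.
Proof.
move=> xC; apply/eqP; rewrite -normr_le0.
have z1 : `|2^-1 : R| < 1 by rewrite ger0_norm// invf_lt1// ltr1n.
rewrite -(cvg_lim _ (cvg_geometric C z1))//; apply: limr_ge.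
  exact: cvgP (cvg_geometric C z1).
by apply: nearW => n; exact: xC.
Qed.

Lemma conv_seriesP kappa lambda : Cm1 kappa ->
  Cm1 (conv_series kappa lambda) /\
  exists N : nat, forall T, exists C, forall n t, 0 < t <= T ->
    `|conv_series kappa lambda t - \sum_(k < N + n) series_term kappa lambda k t|
      <= C * 2^-1 ^+ n.
Proof.
move=> ck; have [N [S [cS SP]]] := series_tail kappa lambda ck.
have lE t : 0 < t -> conv_series kappa lambda t =
    \sum_(k < N) series_term kappa lambda k t + S t.
  move=> t0; have [C SC] := SP t.
  apply/cvg_lim => //; rewrite -(cvg_shiftn N) /=.
  have h : \sum_(k < n) series_term kappa lambda (N + k) t @[n --> \oo] --> S t.
    apply/cvgrPdist_le => e e0.
    have z1 : `|2^-1 : R| < 1 by rewrite ger0_norm// invf_lt1// ltr1n.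
    have /cvgrPdist_le/(_ _ e0)[n _ nP] := cvg_geometric C z1.
    exists n => // m /= /nP; rewrite sub0r normrN => /(le_trans (ler_norm _)).
    by apply: le_trans; apply: SC; rewrite t0 lexx.
  rewrite (_ : (fun n => _) = (fun n => \sum_(k < N) series_term kappa lambda k t +
      \sum_(k < n) series_term kappa lambda (N + k) t)).
    by apply: cvgD; [exact: cvg_cst|exact: h].
  apply/funext => n; rewrite big_add1 /= addnC big_mkord big_split_ord /=.
  by congr (_ + _).
split.
  apply: (Cm1_ext (fun t => \sum_(k < N) series_term kappa lambda k t + S t)).
    by move=> t t0; rewrite lE.
  apply: Cm1D; last exact: continuous_Cm1.
  by apply: Cm1_sum => i _; exact: Cm1_series_term.
exists N => T; have [C SC] := SP T; exists C => n t /andP[t0 tT].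
rewrite lE// big_split_ord /= opprD addrACA subrr add0r.
by apply: SC; rewrite t0.
Qed.

Lemma Cm1_conv_series kappa lambda : Cm1 kappa -> Cm1 (conv_series kappa lambda).
Proof. by move=> ck; have [] := conv_seriesP kappa lambda ck. Qed.

(** The partial sums P_n satisfy P_(n+1) = kappa + lambda kappa * P_n, and the error
    l - P_n is uniformly of order 2^(-n) on bounded intervals. *)
Lemma conv_series_eq kappa lambda t : Cm1 kappa -> 0 < t ->
  conv_series kappa lambda t =
  kappa t + lambda * laplace_conv kappa (conv_series kappa lambda) t.
Proof.
move=> ck t0; have [cl [N lP]] := conv_seriesP kappa lambda ck.
have [C lC] := lP t.
set l := conv_series kappa lambda in cl lC *.
pose P n x := \sum_(k < N + n) series_term kappa lambda k x.
have cP n : Cm1 (P n) by apply: Cm1_sum => i _; exact: Cm1_series_term.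
have PS n : P n.+1 t = kappa t + lambda * laplace_conv kappa (P n) t.
  rewrite /P addnS big_ord_recl conv_sumr//; last first.
    by move=> i _; exact: Cm1_series_term.
  rewrite /series_term expr0 mul1r mulr_sumr; congr (_ + _).
  by apply: eq_bigr => i _; rewrite -series_termS.
apply/eqP; rewrite -subr_eq0; apply/eqP.
pose A := laplace_conv (fun x => `|kappa x|) (fun=> 1) t.
apply: (eq0_geometric _ (`|C| + `|lambda| * (`|C| * A))) => n.
have -> : l t - (kappa t + lambda * laplace_conv kappa l t) =
  (l t - P n.+1 t) + - (lambda * laplace_conv kappa (fun x => l x - P n x) t).
  by rewrite convBr// PS; ring.
apply: le_trans (ler_normD _ _) _; rewrite mulrDl lerD//.
  apply: le_trans (lC n.+1 t _) _; first by rewrite t0 lexx.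
  rewrite exprS mulrA ler_wpM2r ?exprn_ge0//.
  apply: (@le_trans _ _ (`|C| * 2^-1)); first by rewrite ler_wpM2r// ler_norm.
  by rewrite ler_piMr// invf_le1// ler1n.
rewrite normrN normrM -!mulrA ler_wpM2l//.
apply: (@le_trans _ _
  (laplace_conv (fun x => `|kappa x|) (fun x => `|C| * 2^-1 ^+ n * 1) t)).
  apply: norm_conv_le => //; [exact: Cm1B|exact/Cm1Z/Cm1_cst|].
  move=> x /andP[x0 xt]; apply: le_trans (lC n x _) _; first by rewrite x0 ltW.
  by rewrite mulr1 ler_wpM2r ?exprn_ge0// ler_norm.
rewrite convZr//; [|exact: Cm1_norm|exact: Cm1_cst].
by rewrite -/A mulrAC mulrA.
Qed.

End Resolvent.

(** * Iterated derivatives and antiderivatives *)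

Section IteratedDerivatives.
Context {R : realType}.
Implicit Types (f g h u v w : R -> R) (t : R).

Definition intn (m : nat) (f : R -> R) : R -> R := iter m antider f.

Lemma Cm1_intn m f : Cm1 f -> Cm1 (intn m f).
Proof. by move=> cf; elim: m => [//|m IH]; exact: Cm1_antider. Qed.

Lemma intnD m j f : intn (m + j) f = intn m (intn j f).
Proof. exact: iterD. Qed.

Lemma conv_antider f g : Cm1 f -> Cm1 g ->
  laplace_conv f (antider g) = antider (laplace_conv f g).
Proof.
move=> cf cg; have c1 := Cm1_cst (1 : R); apply/funext => t.
rewrite /antider -(convA _ _ _ _ cf c1 cg) -(convA _ _ _ _ c1 cf cg).
by apply: eq_conv => // s _; exact: convC.
Qed.

Lemma conv_intn m f g : Cm1 f -> Cm1 g ->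
  laplace_conv f (intn m g) = intn m (laplace_conv f g).
Proof.
move=> cf cg; elim: m => [//|m IH].
by rewrite /intn !iterS conv_antider ?IH//; exact: Cm1_intn.
Qed.

(** Equality is asked for t > 0 only, whereas [derive1n] returns a function on the
    whole line; the lemmas below transport it along such equalities. *)
Definition has_derive1n (m : nat) (u v : R -> R) : Prop :=
  derivable_upto m u /\ forall t, 0 < t -> derive1n m u t = v t.

Lemma near_gt0_eq u v t : (forall t, 0 < t -> u t = v t) -> 0 < t ->
  {near t, u =1 v}.
Proof.
by move=> uv t0; near=> x; apply: uv; near: x; exact: lt_nbhsr.
Unshelve. all: by end_near. Qed.

Lemma derivable_ext u v t : (forall t, 0 < t -> u t = v t) -> 0 < t ->
  derivable u t 1 -> derivable v t 1.
Proof. by move=> uv t0; apply: near_eq_derivable; exact: near_gt0_eq. Qed.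

Lemma eq_derive1n i u v : (forall t, 0 < t -> u t = v t) ->
  forall t, 0 < t -> derive1n i u t = derive1n i v t.
Proof.
move=> uv; elim: i => [//|i IH] t t0.
by rewrite !derive1nS !derive1E; apply: near_eq_derive; exact: near_gt0_eq.
Qed.

Lemma derivable_upto_ext m u v : (forall t, 0 < t -> u t = v t) ->
  derivable_upto m u -> derivable_upto m v.
Proof.
move=> uv du i im t t0; apply: derivable_ext (du i im t t0) => //.
exact: eq_derive1n.
Qed.

Lemma has_derive1n_ext m u u' v v' : (forall t, 0 < t -> u t = u' t) ->
  (forall t, 0 < t -> v t = v' t) -> has_derive1n m u v -> has_derive1n m u' v'.
Proof.
move=> uu vv [du uv]; split; first exact: derivable_upto_ext du.
by move=> t t0; rewrite -vv// -uv//; apply/esym/eq_derive1n.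
Qed.

Lemma has_derive1n_unique m u u' v v' : (forall t, 0 < t -> u t = u' t) ->
  has_derive1n m u v -> has_derive1n m u' v' -> forall t, 0 < t -> v t = v' t.
Proof.
by move=> uu [_ uv] [_ uv'] t t0; rewrite -uv// -uv'//; exact: eq_derive1n.
Qed.

Lemma has_derive1n0 u : has_derive1n 0 u u.
Proof. by []. Qed.

Lemma has_derive1nS m u w v : (forall t, 0 < t -> is_derive t 1 u (w t)) ->
  has_derive1n m w v -> has_derive1n m.+1 u v.
Proof.
move=> uw [dw wv].
have uw' t : 0 < t -> (derive1 u) t = w t.
  by move=> t0; rewrite derive1E; have [_ ->] := uw t t0.
split=> [[|i] im t t0|t t0].
- by have [] := uw t t0.
- rewrite derive1Sn; apply: derivable_ext (dw i im t t0) => //.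
  by move=> s s0; apply/esym/eq_derive1n.
- by rewrite derive1Sn -wv//; exact: eq_derive1n.
Qed.

Lemma has_derive1nS_inv m u v : has_derive1n m.+1 u v ->
  (forall t, 0 < t -> is_derive t 1 u ((derive1 u) t)) /\ has_derive1n m (derive1 u) v.
Proof.
move=> [du uv]; split.
  by move=> t t0; apply: DeriveDef; [exact: (du 0%N)|rewrite derive1E].
split; last by move=> t t0; rewrite -derive1Sn uv.
by move=> i im t t0; rewrite -derive1Sn; exact: du.
Qed.

Lemma has_derive1n_trans i j u v w : has_derive1n i u v -> has_derive1n j v w ->
  has_derive1n (i + j) u w.
Proof.
elim: i u => [|i IH] u uv vw.
  by apply: has_derive1n_ext vw => // t t0; exact/esym/(uv.2 t t0).
have [uu' u'v] := has_derive1nS_inv _ _ _ uv.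
by rewrite addSn; apply: has_derive1nS uu' _; exact: IH.
Qed.

Lemma derivable_upto_has i m u : derivable_upto m u -> (i <= m)%N ->
  has_derive1n i u (derive1n i u).
Proof. by move=> du im; split=> // j ji; apply: du; exact: leq_trans im. Qed.

Lemma has_derive1nD m u u' v v' : has_derive1n m u v -> has_derive1n m u' v' ->
  has_derive1n m (fun t => u t + u' t) (fun t => v t + v' t).
Proof.
elim: m u u' => [|m IH] u u' uv uv'.
  by split=> // t t0; rewrite -(uv.2 t t0) -(uv'.2 t t0).
have [du uv1] := has_derive1nS_inv _ _ _ uv.
have [du' uv1'] := has_derive1nS_inv _ _ _ uv'.
apply: has_derive1nS (IH _ _ uv1 uv1') => t t0.
by apply: is_deriveD; [exact: du|exact: du'].
Qed.

Lemma has_derive1nZ m (c : R) u v : has_derive1n m u v ->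
  has_derive1n m (fun t => c * u t) (fun t => c * v t).
Proof.
elim: m u => [|m IH] u uv; first by split=> // t t0; rewrite -(uv.2 t t0).
have [du uv1] := has_derive1nS_inv _ _ _ uv.
apply: has_derive1nS (IH _ uv1) => t t0.
by apply: is_deriveZ; exact: du.
Qed.

Lemma has_derive1n_cst0 m : has_derive1n m (fun=> 0) (fun=> 0).
Proof.
elim: m => [|m IH]; first by split.
by apply: has_derive1nS IH => t t0; exact: is_derive_cst.
Qed.

Lemma has_derive1n_sum m (k : nat) (u v : nat -> R -> R) :
  (forall i, (i < k)%N -> has_derive1n m (u i) (v i)) ->
  has_derive1n m (fun t => \sum_(i < k) u i t) (fun t => \sum_(i < k) v i t).
Proof.
elim: k => [|k IH] uv.
  by apply: has_derive1n_ext (has_derive1n_cst0 m) => t t0; rewrite big_ord0.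
have IHk := IH (fun i ik => uv i (ltnW ik)).
by apply: has_derive1n_ext (has_derive1nD _ _ _ _ _ IHk (uv k (ltnSn k))) => t t0;
  rewrite big_ord_recr.
Qed.

Lemma has_derive1n_intn m f : Cm1 f -> has_derive1n m (intn m f) f.
Proof.
move=> cf; elim: m => [|m IH]; first by split.
apply: has_derive1nS IH => t t0.
by apply: is_derive_antider => //; exact: Cm1_intn.
Qed.

Lemma has_derive1n_intnD i j f : Cm1 f -> has_derive1n i (intn (i + j) f) (intn j f).
Proof. by move=> cf; rewrite intnD; apply/has_derive1n_intn/Cm1_intn. Qed.

Lemma intnS_cvg0 m f : Cm1 f -> intn m.+1 f t @[t --> 0^'+] --> 0.
Proof. by move=> cf; apply/antider_cvg0/Cm1_intn. Qed.

(** By induction: h_(m+2) is the antiderivative of h_(m+1) that vanishes at 0. *)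
Lemma hfun_intn m t : 0 < t -> hfun m.+1 t = intn m (fun=> 1) t.
Proof.
elim: m t => [|m IH] t t0; first by rewrite /hfun /= expr0 fact0 divr1.
have dh (s : R) : 0 < s -> is_derive s 1 (@hfun R m.+2) (intn m (fun=> 1) s).
  move=> s0; rewrite -IH//.
  have -> : hfun m.+1 s = (m.+1)`!%:R^-1 *: ((m.+1%:R * s ^+ m) *: (1 : R)).
    rewrite /hfun /GRing.scale /= mulr1 factS natrM.
    by rewrite invfM mulrACA mulVf ?pnatr_eq0// mul1r mulrC.
  have -> : @hfun R m.+2 = (m.+1)`!%:R^-1 \*: (id ^+ m.+1 : R -> R).
    by apply/funext => y; rewrite /hfun /= /GRing.scale /= mulrC exprfctE.
  by apply: is_deriveZ; exact: is_deriveX.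
have cf := Cm1_intn m _ (Cm1_cst 1).
have h : @hfun R m.+2 s @[s --> 0^'+] --> @hfun R m.+2 0.
  apply: cvg_at_right_filter; apply: cvgM; last exact: cvg_cst.
  exact: exprn_continuous.
rewrite {2}/hfun /= expr0n /= mul0r in h.
by rewrite (antiderivative_lim _ _ 0 cf dh h)// add0r.
Qed.

Lemma conv_hfun n f : (0 < n)%N -> Cm1 f -> laplace_conv (@hfun R n) f = intn n f.
Proof.
case: n => // n _ cf; have c1 := Cm1_cst (1 : R).
have ci := Cm1_intn n _ c1.
apply/funext => t; transitivity (laplace_conv (intn n (fun=> 1)) f t).
  by apply: eq_conv => // s s0; exact: hfun_intn.
rewrite convC// conv_intn// (_ : laplace_conv f _ = antider f).
  by rewrite /intn -iterSr.
by apply/funext => s; exact: convC.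
Qed.

End IteratedDerivatives.

(** * Volterra equations of the second kind *)

Section Volterra.
Context {R : realType}.
Implicit Types (f g h k u w y z kappa gamma : R -> R) (t lambda : R).

(** Writing z - lambda kappa * z for g, the claim is
    kappa * z = (l - lambda l * kappa) * z, which holds as l - lambda kappa * l = kappa. *)
Lemma volterra_conv kappa lambda g z : Cm1 kappa -> Cm1 g -> Cm1 z ->
  (forall t, 0 < t -> z t = g t + lambda * laplace_conv kappa z t) ->
  forall t, laplace_conv kappa z t = laplace_conv g (conv_series kappa lambda) t.
Proof.
move=> ck cg cz zE t; have cl := Cm1_conv_series kappa lambda ck.
have ckz := Cm1_conv _ _ ck cz; have ckl := Cm1_conv _ _ ck cl.
set l := conv_series kappa lambda in cl ckl *.
rewrite (convC g l)//.
have -> : laplace_conv l g t =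
    laplace_conv l (fun s => z s - lambda * laplace_conv kappa z s) t.
  by apply: eq_conv => // s s0; rewrite zE// addrK.
rewrite convBr//; last exact: Cm1Z.
rewrite (convZr _ _ _ _ cl ckz) -(convA _ _ _ _ cl ck cz).
have -> : laplace_conv l z t =
    laplace_conv (fun s => kappa s + lambda * laplace_conv kappa l s) z t.
  by apply: eq_conv => // s s0; rewrite /l conv_series_eq.
rewrite convDl//; last exact: Cm1Z.
rewrite (convZl _ _ _ _ ckl cz).
rewrite (_ : laplace_conv (laplace_conv l kappa) z t =
    laplace_conv (laplace_conv kappa l) z t).
  by rewrite addrK.
by apply: eq_conv => // s _; exact: convC.
Qed.

Lemma volterra_unique kappa lambda g z : Cm1 kappa -> Cm1 g -> Cm1 z ->
  (forall t, 0 < t -> z t = g t + lambda * laplace_conv kappa z t) ->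
  forall t, 0 < t -> z t = g t + lambda * laplace_conv g (conv_series kappa lambda) t.
Proof.
by move=> ck cg cz zE t t0; rewrite zE// (volterra_conv kappa lambda g z).
Qed.

(** Stated for kappa * z instead of z, where z = g + lambda g * l: then
    kappa * z = g * (kappa + lambda kappa * l) = g * l. *)
Lemma volterra_exists kappa lambda g t : Cm1 kappa -> Cm1 g ->
  laplace_conv kappa
    (fun s => g s + lambda * laplace_conv g (conv_series kappa lambda) s) t =
  laplace_conv g (conv_series kappa lambda) t.
Proof.
move=> ck cg; have cl := Cm1_conv_series kappa lambda ck.
set l := conv_series kappa lambda in cl *.
have cgl := Cm1_conv _ _ cg cl; have ckl := Cm1_conv _ _ ck cl.
rewrite convDr//; last exact: Cm1Z.
rewrite (convZr _ _ _ _ ck cgl) -(convA _ _ _ _ ck cg cl) (convC kappa g)//.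
have -> : laplace_conv (laplace_conv kappa g) l t = laplace_conv (laplace_conv g kappa) l t.
  by apply: eq_conv => // s _; exact: convC.
rewrite (convA _ _ _ _ cg ck cl) -(convZr _ _ _ _ cg ckl) -convDr//; last exact: Cm1Z.
by apply: eq_conv => // s s0; rewrite [RHS]conv_series_eq.
Qed.

(** The Volterra equation has the inhomogeneity g = gamma + kappa * f, and the formula
    follows from f * l = kappa * f + lambda (kappa * f) * l. *)
Lemma mild_solutionP kappa lambda f gamma y : Cm1 kappa -> Cm1 f -> Cm1 gamma -> Cm1 y ->
  (forall t, 0 < t ->
    y t = gamma t + laplace_conv kappa (fun s => f s + lambda * y s) t) <->
  (forall t, 0 < t -> y t = y_f kappa lambda f t + y_iv kappa lambda gamma t).
Proof.
move=> ck cf cg cy; have cl := Cm1_conv_series kappa lambda ck.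
have ckf := Cm1_conv _ _ ck cf; have ckl := Cm1_conv _ _ ck cl.
pose g t := gamma t + laplace_conv kappa f t.
have cg' : Cm1 g by exact: Cm1D.
have splitE t : laplace_conv kappa (fun s => f s + lambda * y s) t =
    laplace_conv kappa f t + lambda * laplace_conv kappa y t.
  by rewrite convDr ?convZr//; exact: Cm1Z.
have gE t : 0 < t -> g t + lambda * laplace_conv g (conv_series kappa lambda) t =
    y_f kappa lambda f t + y_iv kappa lambda gamma t.
  move=> t0; rewrite /y_f /y_iv /g convDl//.
  have -> : laplace_conv f (conv_series kappa lambda) t =
      laplace_conv f (fun s => kappa s +
        lambda * laplace_conv kappa (conv_series kappa lambda) s) t.
    by apply: eq_conv => // s s0; rewrite [LHS]conv_series_eq.
  rewrite convDr//; last exact: Cm1Z.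
  rewrite (convZr _ _ _ _ cf ckl) -(convA _ _ _ _ cf ck cl) (convC f kappa)//.
  have -> : laplace_conv (laplace_conv f kappa) (conv_series kappa lambda) t =
      laplace_conv (laplace_conv kappa f) (conv_series kappa lambda) t.
    by apply: eq_conv => // s _; exact: convC.
  ring.
split=> yE t t0.
  rewrite -gE//; apply: volterra_unique => // s s0.
  by rewrite yE// splitE /g addrA.
rewrite splitE addrA -/(g t) yE// -gE//; congr (_ + _ * _).
rewrite -(volterra_exists _ _ _ _ ck cg'); apply: eq_conv => // s s0.
by rewrite gE// yE.
Qed.

End Volterra.

(** * Differentiation of convolutions and of the convolution series *)

Section Regularity.
Context {R : realType}.
Implicit Types (f g h k l u w y z kappa gamma : R -> R) (t lambda : R).

(** Downwards induction: a function with derivative in the class is a constant plus an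
    antiderivative. *)
Lemma Cm1_order_derive1n m g i : Cm1_order m g -> (i <= m)%N -> Cm1 (derive1n i g).
Proof.
move=> [_ dg cg] im; rewrite -(subKn im).
elim: (m - i)%N (leq_subr i m) => [|j IH] jm; first by rewrite subn0.
have jm' : (m - j.+1 < m)%N by rewrite ltn_subrL ltn0Sn (leq_trans _ jm).
have E : (m - j = (m - j.+1).+1)%N by rewrite subnSK.
have cj := IH (ltnW jm); rewrite E derive1nS in cj.
have du t : 0 < t ->
    is_derive t 1 (derive1n (m - j.+1) g) (derive1 (derive1n (m - j.+1) g) t).
  by move=> t0; apply: DeriveDef; [exact: dg|rewrite derive1E].
have [c cE] := antiderivative_antider _ _ cj du.
apply: (Cm1_ext (fun t => c + antider (derive1 (derive1n (m - j.+1) g)) t)).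
  by move=> t t0; rewrite cE.
by apply: Cm1D; [exact: Cm1_cst|exact: Cm1_antider].
Qed.

(** If c is the limit of g at 0+, then g = c + h_1 * g', so that
    l * g = c (h_1 * l) + h_1 * (l * g') has the derivative c l + l * g'. Each
    derivative of g costs one of l, except the first. *)
Lemma derivable_upto_conv m l g : Cm1 l -> derivable_upto m.-1 l -> Cm1_order m g ->
  derivable_upto m (laplace_conv l g).
Proof.
elim: m g => [|m IH] g cl dl og; first by move=> i; rewrite ltn0.
have [cg dg cgm] := og.
have cg' : Cm1 (derive1 g) by exact: (Cm1_order_derive1n m.+1 g 1 og).
have dug t : 0 < t -> is_derive t 1 g (derive1 g t).
  by move=> t0; apply: DeriveDef; [exact: (dg 0%N)|rewrite derive1E].
have [c cE] := antiderivative_antider _ _ cg' dug.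
have og' : Cm1_order m (derive1 g).
  split; [exact: cg'| |by rewrite -derive1Sn].
  by move=> i im t t0; rewrite -derive1Sn; exact: dg.
have clg := Cm1_conv _ _ cl cg'.
have convE t : laplace_conv l g t =
    c * antider l t + antider (laplace_conv l (derive1 g)) t.
  rewrite -conv_antider//.
  have -> : antider l t = laplace_conv l (fun=> 1) t by apply: convC => //; exact: Cm1_cst.
  have c1 := Cm1_cst (1 : R); have ca := Cm1_antider _ cg'.
  rewrite -(convZr _ _ _ _ cl c1) -convDr//; last exact: Cm1Z.
  by apply: eq_conv => // s s0; rewrite cE// mulr1.
have dl' : derivable_upto m.-1 l.
  by move=> i im; apply: dl; exact: leq_trans im (leq_pred _).
have h1 := derivable_upto_has _ _ _ (IH _ cl dl' og') (leqnn m).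
have h2 := derivable_upto_has _ _ _ dl (leqnn m).
have h3 := has_derive1nD _ _ _ _ _ (has_derive1nZ m c _ _ h2) h1.
apply: (derivable_upto_ext _ (fun t => c * antider l t +
    antider (laplace_conv l (derive1 g)) t)).
  by move=> t _; rewrite convE.
apply: (proj1 (has_derive1nS m _ _ _ _ h3)) => t t0.
apply: is_deriveD; last exact: is_derive_antider.
by apply: is_deriveZ; exact: is_derive_antider.
Qed.

(** By induction on the order, from l = kappa + lambda l * kappa and the gain of one
    order in [derivable_upto_conv]. *)
Lemma derivable_upto_conv_series m kappa lambda : Cm1_order m kappa ->
  derivable_upto m (conv_series kappa lambda).
Proof.
move=> ok; have [ck dk _] := ok; have cl := Cm1_conv_series kappa lambda ck.
suff main : forall j, (j <= m)%N -> derivable_upto j (conv_series kappa lambda).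
  exact: main.
elim=> [_ i|j IH jm]; first by rewrite ltn0.
have dj : derivable_upto j.+1 kappa by move=> i ij; apply: dk; exact: leq_trans jm.
have oj : Cm1_order j.+1 kappa.
  by split=> //; exact: Cm1_order_derive1n ok jm.
have dc := derivable_upto_conv j.+1 _ _ cl (IH (ltnW jm)) oj.
have h1 := derivable_upto_has _ _ _ dj (leqnn _).
have h2 := derivable_upto_has _ _ _ dc (leqnn _).
have [h3 _] := has_derive1nD _ _ _ _ _ h1 (has_derive1nZ _ lambda _ _ h2).
apply: derivable_upto_ext h3 => t t0.
by rewrite [RHS]conv_series_eq// (convC _ kappa).
Qed.

Lemma taylor_antider n u (a : nat -> R) : derivable_upto n u -> Cm1 (derive1n n u) ->
  (forall i, (i < n)%N -> derive1n i u t @[t --> 0^'+] --> a i) ->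
  forall t, 0 < t ->
  u t = \sum_(i < n) a i * intn i (fun=> 1) t + intn n (derive1n n u) t.
Proof.
elim: n u a => [|n IH] u a du cu ua t t0; first by rewrite big_ord0 add0r.
have c1 := Cm1_cst (1 : R).
have du' : derivable_upto n (derive1 u).
  by move=> i im s s0; rewrite -derive1Sn; exact: du.
have cu' : Cm1 (derive1n n (derive1 u)) by rewrite -derive1Sn.
have u'E := IH (derive1 u) (fun i => a i.+1) du' cu'.
have {}u'E s : 0 < s -> derive1 u s = \sum_(i < n) a i.+1 * intn i (fun=> 1) s +
    intn n (derive1n n.+1 u) s.
  move=> s0; rewrite u'E// ?derive1Sn// => i im.
  by rewrite -derive1Sn; exact: ua.
set S := fun s => \sum_(i < n) a i.+1 * intn i (fun=> 1) s.
have ci (i : nat) : Cm1 (fun s => a i.+1 * intn i (fun=> 1) s) by exact/Cm1Z/Cm1_intn.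
have cS : Cm1 S by apply: Cm1_sum => i _; exact: ci.
have cI := Cm1_intn n _ cu.
have cW := Cm1D _ _ cS cI.
have duW (s : R) : 0 < s -> is_derive s 1 u (S s + intn n (derive1n n.+1 u) s).
  by move=> s0; rewrite -u'E//; apply: DeriveDef; [exact: (du 0%N)|rewrite derive1E].
rewrite (antiderivative_lim _ _ (a 0%N) cW duW (ua 0%N isT) t t0).
rewrite /antider convDr// big_ord_recl /= mulr1 -addrA; congr (_ + (_ + _)).
rewrite (conv_sumr _ n (fun i s => a i.+1 * intn i (fun=> 1) s) _ c1)//.
apply: eq_bigr => i _; have cii := Cm1_intn i _ c1.
by rewrite (convZr _ _ _ _ c1 cii).
Qed.

(** Differentiate n times: i + 1 of the derivatives undo the antiderivatives of q, and
    n - 1 - i are left. *)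
Lemma intn_sum_derive1n n (a : nat -> R) w q : Cm1 w -> Cm1 q -> derivable_upto n.-1 q ->
  (forall t, 0 < t -> intn n w t = \sum_(i < n) a i * intn i.+1 q t) ->
  forall t, 0 < t -> w t = \sum_(i < n) a i * derive1n (n.-1 - i) q t.
Proof.
move=> cw cq dq wE; have hw := has_derive1n_intn n _ cw.
apply: (has_derive1n_unique _ _ _ _ _ wE hw).
apply: (has_derive1n_sum _ _ (fun i t => a i * intn i.+1 q t)
  (fun i t => a i * derive1n (n.-1 - i) q t)) => i im; apply: has_derive1nZ.
rewrite -{1}(subnKC im).
apply: has_derive1n_trans; first exact: has_derive1n_intn.
case: n im dq {wE hw} => [//|n] im dq; rewrite subSS /= in dq *.
by apply: derivable_upto_has dq _; exact: leq_subr.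
Qed.

End Regularity.

(** * Initial-value problems for the general fractional derivative *)

Section InitialValueProblems.
Context {R : realType}.
Implicit Types (f g h k l u w y z kappa gamma : R -> R) (t lambda : R).

Lemma Cm10_Cm1 k : Cm10 k -> Cm1 k.
Proof. by move=> [p [f1 [/andP[p1 _] cf fE]]]; exists p, f1. Qed.

(** kappa * k = h_n turns k * (kappa * phi) into the n-fold antiderivative of phi. *)
Lemma GFI_mild n kappa k gamma phi y : (0 < n)%N -> kernel_pair n kappa k ->
  Cm1 gamma -> Cm1 phi ->
  (forall t, 0 < t -> y t = gamma t + laplace_conv kappa phi t) ->
  forall t, GFI k y t = GFI k gamma t + intn n phi t.
Proof.
move=> n0 [ck /Cm10_Cm1 ck' kk] cg cp yE t; rewrite /GFI.
have ckp := Cm1_conv _ _ ck cp.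
have -> : laplace_conv k y t =
    laplace_conv k (fun s => gamma s + laplace_conv kappa phi s) t.
  exact: eq_conv.
rewrite convDr// -(convA _ _ _ _ ck' ck cp) -(conv_hfun _ _ n0 cp); congr (_ + _).
by apply: eq_conv => // s s0; rewrite convC// kk.
Qed.

Lemma GFD_mild n kappa k gamma phi y : (0 < n)%N -> kernel_pair n kappa k ->
  GFD_ker n k gamma -> Cm1 phi ->
  (forall t, 0 < t -> y t = gamma t + laplace_conv kappa phi t) ->
  GFD_dom n k y /\ forall t, 0 < t -> GFD n k y t = phi t.
Proof.
move=> n0 kP [[cg dg _] g0] cp yE; have [ck _ _] := kP.
have kE := GFI_mild n kappa k gamma phi y n0 kP cg cp yE.
have hg : has_derive1n n (GFI k gamma) (fun=> 0) by split.
have hy : has_derive1n n (GFI k y) phi.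
  apply: has_derive1n_ext (has_derive1nD _ _ _ _ _ hg (has_derive1n_intn n _ cp)) => t t0.
    by rewrite kE.
  by rewrite add0r.
split; last exact: hy.2; split; [|exact: hy.1|].
  apply: (Cm1_ext (fun t => gamma t + laplace_conv kappa phi t)).
    by move=> t t0; rewrite yE.
  by apply: Cm1D => //; exact: Cm1_conv.
by apply: Cm1_ext cp => t t0; rewrite -hy.2.
Qed.

(** For a solution of the equation, f + lambda y is the derivative of y, and the mild
    equation is the definition of the projector. *)
Lemma projector_mild n kappa k f lambda gamma y :
  GFD_equation n k lambda f y -> 
  (forall t, 0 < t ->
    y t = gamma t + laplace_conv kappa (fun s => f s + lambda * y s) t) <->
  (forall t, 0 < t -> projector n kappa k y t = gamma t).
Proof.
move=> yE; have E t : GFI kappa (GFD n k y) t =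
    laplace_conv kappa (fun s => f s + lambda * y s) t.
  by apply: eq_conv => // s s0; rewrite -(yE s s0) subrK.
split=> h t t0; first by rewrite /projector E h// addrK.
by rewrite -[in RHS](h t t0) /projector E subrK.
Qed.

Lemma ivp_projector_solution n kappa k lambda f gamma0 : (0 < n)%N ->
  kernel_pair n kappa k -> Cm1 f -> GFD_ker n k gamma0 ->
  is_unique_solution (IVP_projector n kappa k lambda f gamma0)
    (fun t => y_f kappa lambda f t + y_iv kappa lambda gamma0 t).
Proof.
move=> n0 kP cf gP; have [ck _ _] := kP; have [[cg _ _] _] := gP.
have cl := Cm1_conv_series kappa lambda ck.
have cy : Cm1 (fun t => y_f kappa lambda f t + y_iv kappa lambda gamma0 t).
  apply: Cm1D; first exact: Cm1_conv.
  by apply: Cm1D => //; apply: Cm1Z; exact: Cm1_conv.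
split.
  set y := (fun t => _) in cy *.
  have yE := (mild_solutionP kappa lambda f gamma0 y ck cf cg cy).2 (fun t _ => erefl).
  have cp : Cm1 (fun s => f s + lambda * y s) by apply: Cm1D => //; exact: Cm1Z.
  have [dy Dy] := GFD_mild n kappa k gamma0 _ y n0 kP gP cp yE.
  have eqy : GFD_equation n k lambda f y by move=> t t0; rewrite Dy// addrK.
  by split=> //; apply/(projector_mild n kappa k f lambda).
move=> z [[cz _ _] eqz Fz]; apply/mild_solutionP => //.
exact/(projector_mild n kappa k f lambda _ z eqz).
Qed.

Lemma is_unique_solution_ext (P : (R -> R) -> Prop) y z :
  (forall u v, (forall t, 0 < t -> u t = v t) -> P u -> P v) ->
  (forall t, 0 < t -> y t = z t) -> is_unique_solution P y -> is_unique_solution P z.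
Proof.
move=> Pext yz [Py yP]; split; first exact: Pext yz Py.
by move=> u Pu t t0; rewrite -yz// (yP u Pu).
Qed.

Lemma eq_GFI k y z : (forall t, 0 < t -> y t = z t) -> GFI k y = GFI k z.
Proof. by move=> yz; apply/funext => t; exact: eq_conv. Qed.

Lemma GFD_dom_ext n k y z : (forall t, 0 < t -> y t = z t) ->
  GFD_dom n k y -> GFD_dom n k z.
Proof.
move=> yz; rewrite /GFD_dom /GFD (eq_GFI k _ _ yz) => -[cy dy cD].
by split; [exact: Cm1_ext yz cy|exact: dy|exact: cD].
Qed.

Lemma GFD_equation_ext n k lambda f f' y z : (forall t, 0 < t -> f t = f' t) ->
  (forall t, 0 < t -> y t = z t) ->
  GFD_equation n k lambda f y -> GFD_equation n k lambda f' z.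
Proof.
move=> ff yz yE t t0; rewrite /GFD -(eq_GFI k _ _ yz) -yz// -ff//.
exact: yE.
Qed.

Lemma IVP_projector_ext n kappa k lambda f gamma0 y z : (forall t, 0 < t -> y t = z t) ->
  IVP_projector n kappa k lambda f gamma0 y -> IVP_projector n kappa k lambda f gamma0 z.
Proof.
move=> yz [dy eqy Fy]; split; [exact: GFD_dom_ext yz dy| |].
  exact: GFD_equation_ext yz eqy.
move=> t t0; rewrite -(Fy t t0) /projector /GFD (eq_GFI k _ _ yz) (yz t t0).
reflexivity.
Qed.

Lemma IVP_values_ext n k lambda f (a : 'I_n -> R) y z : (forall t, 0 < t -> y t = z t) ->
  IVP_values k lambda f a y -> IVP_values k lambda f a z.
Proof.
move=> yz [dy eqy ay]; split; [exact: GFD_dom_ext yz dy| |].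
  exact: GFD_equation_ext yz eqy.
by move=> i; rewrite -(eq_GFI k _ _ yz).
Qed.

Lemma GFD_ker0 n k : Cm10 k -> GFD_ker n k (fun=> 0).
Proof.
move=> /Cm10_Cm1 ck; have c0 := Cm1_cst (0 : R).
have h : has_derive1n n (GFI k (fun=> 0)) (fun=> 0).
  apply: has_derive1n_ext (has_derive1n_cst0 n) => // t t0.
  by rewrite /GFI laplace_conv0r.
split; last exact: h.2.
split; [exact: c0|exact: h.1|apply: Cm1_ext c0 => t t0].
exact/esym/(h.2 t t0).
Qed.


Lemma GFI_taylor n k y (a : nat -> R) : GFD_dom n k y ->
  (forall i, (i < n)%N -> derive1n i (GFI k y) t @[t --> 0^'+] --> a i) ->
  forall t, 0 < t -> GFI k y t =
    \sum_(i < n) a i * intn i (fun=> 1) t + intn n (GFD n k y) t.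
Proof. by move=> [_ dy cy] ya; exact: taylor_antider. Qed.

(** In the Taylor formula of k * y, the remainder is k * (kappa * D y), which is what
    the projector removes. *)
Lemma projector_values n kappa k y (a : nat -> R) : (0 < n)%N -> kernel_pair n kappa k ->
  GFD_dom n k y ->
  (forall i, (i < n)%N -> derive1n i (GFI k y) t @[t --> 0^'+] --> a i) ->
  Cm1 (projector n kappa k y) /\
  forall t, 0 < t -> GFI k (projector n kappa k y) t =
    \sum_(i < n) a i * intn i (fun=> 1) t.
Proof.
move=> n0 kP dy ya; have [ck _ _] := kP; have [cy _ cD] := dy.
have cF : Cm1 (projector n kappa k y) by apply: Cm1B => //; exact: Cm1_conv.
split=> // t t0; apply: (addIr (intn n (GFD n k y) t)).
rewrite -(GFI_mild n kappa k _ _ y n0 kP cF cD); first exact: GFI_taylor.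
by move=> s s0; rewrite /projector subrK.
Qed.

Lemma conv_cst1 f : Cm1 f -> laplace_conv f (fun=> 1) = antider f.
Proof. by move=> cf; apply/funext => t; apply: convC => //; exact: Cm1_cst. Qed.

Lemma conv_sum_intn f n (a : nat -> R) g t : Cm1 f -> Cm1 g ->
  laplace_conv f (fun s => \sum_(i < n) a i * intn i g s) t =
  \sum_(i < n) a i * intn i (laplace_conv f g) t.
Proof.
move=> cf cg; have ci i := Cm1_intn i _ cg.
rewrite (conv_sumr f n (fun i s => a i * intn i g s) t cf) => [|i _]; last exact: Cm1Z.
by apply: eq_bigr => i _; rewrite (convZr _ _ _ _ cf (ci i)) conv_intn.
Qed.

(** Convolve k * gamma = sum_i a_i h_(i+1) with kappa. *)
Lemma intn_kernel_part n kappa k (a : nat -> R) gamma : (0 < n)%N ->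
  kernel_pair n kappa k -> Cm1 gamma ->
  (forall t, 0 < t -> GFI k gamma t = \sum_(i < n) a i * intn i (fun=> 1) t) ->
  forall t, intn n gamma t = \sum_(i < n) a i * intn i.+1 kappa t.
Proof.
move=> n0 [ck /Cm10_Cm1 ck' kk] cg gE t; have c1 := Cm1_cst (1 : R).
rewrite -(conv_hfun _ _ n0 cg).
have -> : laplace_conv (@hfun R n) gamma t = laplace_conv (laplace_conv kappa k) gamma t.
  by apply: eq_conv => // s s0; rewrite kk.
rewrite (convA _ _ _ _ ck ck' cg).
have -> : laplace_conv kappa (laplace_conv k gamma) t =
    laplace_conv kappa (fun s => \sum_(i < n) a i * intn i (fun=> 1) s) t.
  exact: eq_conv.
rewrite (conv_sum_intn _ _ _ _ _ ck c1) (conv_cst1 _ ck).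
by apply: eq_bigr => i _; rewrite /intn iterSr.
Qed.

Lemma derive1n_conv_series m kappa lambda i t : Cm1_order m kappa -> (i <= m)%N -> 0 < t ->
  derive1n i (conv_series kappa lambda) t = derive1n i kappa t +
  lambda * derive1n i (laplace_conv (conv_series kappa lambda) kappa) t.
Proof.
move=> ok im t0; have [ck dk _] := ok; have cl := Cm1_conv_series kappa lambda ck.
have dl := derivable_upto_conv_series m kappa lambda ok.
have dl' : derivable_upto m.-1 (conv_series kappa lambda).
  by move=> j jm; apply: dl; exact: leq_trans jm (leq_pred _).
have dc := derivable_upto_conv m _ _ cl dl' ok.
have h1 := derivable_upto_has _ _ _ dk im.
have h2 := derivable_upto_has _ _ _ dc im.
have h3 := has_derive1nD _ _ _ _ _ h1 (has_derive1nZ _ lambda _ _ h2).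
rewrite -(h3.2 t t0); apply: eq_derive1n => // s s0.
by rewrite [LHS]conv_series_eq// (convC _ kappa).
Qed.

(** [intn_sum_derive1n] is applied twice, to gamma and kappa and to l * gamma and
    l * kappa; the two sums add up by l = kappa + lambda l * kappa. *)
Lemma y_iv_valuesE n kappa k lambda (a : nat -> R) gamma : (0 < n)%N ->
  kernel_pair n kappa k -> Cm1_order n.-1 kappa -> Cm1 gamma ->
  (forall t, 0 < t -> GFI k gamma t = \sum_(i < n) a i * intn i (fun=> 1) t) ->
  forall t, 0 < t -> y_iv kappa lambda gamma t =
    y_iv_values kappa lambda (fun i : 'I_n => a i) t.
Proof.
move=> n0 kP ok cg gE t t0; have [ck _ _] := kP; have [_ dk _] := ok.
have cl := Cm1_conv_series kappa lambda ck.
set l := conv_series kappa lambda in cl *.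
have dl : derivable_upto n.-1 l by exact: derivable_upto_conv_series.
have dl' : derivable_upto n.-1.-1 l.
  by move=> j jm; apply: dl; exact: leq_trans jm (leq_pred _).
have dlk := derivable_upto_conv n.-1 _ _ cl dl' ok.
have clk := Cm1_conv _ _ cl ck; have clg := Cm1_conv _ _ cl cg.
have inE := intn_kernel_part n kappa k a gamma n0 kP cg gE.
have gammaE := intn_sum_derive1n n a gamma kappa cg ck dk (fun s _ => inE s).
have inlE s : 0 < s -> intn n (laplace_conv l gamma) s =
    \sum_(i < n) a i * intn i.+1 (laplace_conv l kappa) s.
  move=> s0; rewrite -(conv_intn _ _ _ cl cg).
  have -> : laplace_conv l (intn n gamma) s =
      laplace_conv l (fun s => \sum_(i < n) a i * intn i (antider kappa) s) s.
    apply: eq_conv => // r _; rewrite inE; apply: eq_bigr => i _.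
    by rewrite /intn iterSr.
  rewrite (conv_sum_intn _ _ _ _ _ cl (Cm1_antider _ ck)) (conv_antider _ _ cl ck).
  by apply: eq_bigr => i _; rewrite /intn iterSr.
have lgE := intn_sum_derive1n n a _ _ clg clk dlk inlE.
rewrite /y_iv (convC _ _ _ cg cl) gammaE// lgE// mulr_sumr -big_split /=.
apply: eq_bigr => i _; rewrite (derive1n_conv_series n.-1)//; last exact: leq_subr.
by rewrite mulrDr mulrCA.
Qed.

Lemma ivp_values_formula n kappa k lambda f (a : nat -> R) y : (0 < n)%N ->
  kernel_pair n kappa k -> Cm1_order n.-1 kappa -> Cm1 f ->
  IVP_values k lambda f (fun i : 'I_n => a i) y ->
  forall t, 0 < t ->
    y t = y_f kappa lambda f t + y_iv_values kappa lambda (fun i : 'I_n => a i) t.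
Proof.
move=> n0 kP ok cf [dy eqy ay] t t0; have [ck _ _] := kP; have [cy _ _] := dy.
have ya i : (i < n)%N -> derive1n i (GFI k y) t @[t --> 0^'+] --> a i.
  by move=> im; exact: (ay (Ordinal im)).
have [cg gE] := projector_values n kappa k y a n0 kP dy ya.
have mild := (projector_mild n kappa k f lambda _ y eqy).2
  (fun s _ => erefl (projector n kappa k y s)).
rewrite -(y_iv_valuesE n kappa k lambda a _ n0 kP ok cg gE t t0).
exact: ((mild_solutionP kappa lambda f _ y ck cf cg cy).1 mild t t0).
Qed.

Lemma derive1n_intn_cvg0 n j phi : Cm1 phi -> (j < n)%N ->
  derive1n j (intn n phi) t @[t --> 0^'+] --> (0 : R).
Proof.
move=> cp jn; have := intnS_cvg0 (n - j.+1) phi cp; rewrite subnSK//.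
apply: cvg_trans; apply: near_eq_cvg; near=> t.
have := has_derive1n_intnD j (n - j) phi cp; rewrite subnKC ?(ltnW jn)// => h.
by rewrite h.2.
Unshelve. all: by end_near. Qed.

(** Let gamma be the projection of a function u attaining the values. It lies in the
    kernel, and k * gamma differs from k * u only by an n-fold antiderivative, whose
    derivatives of order less than n vanish at 0. *)
Lemma ivp_values_solution n kappa k lambda f (a : nat -> R) : (0 < n)%N ->
  kernel_pair n kappa k -> Cm1_order n.-1 kappa -> Cm1 f ->
  attainable k (fun i : 'I_n => a i) ->
  is_unique_solution (IVP_values k lambda f (fun i : 'I_n => a i))
    (fun t => y_f kappa lambda f t + y_iv_values kappa lambda (fun i : 'I_n => a i) t).
Proof.
move=> n0 kP ok cf [u du ua]; have [ck _ _] := kP; have [cu uD cD] := du.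
split; last first.
  by move=> z zP; exact: (ivp_values_formula n kappa k lambda f a z n0 kP ok cf zP).
have ua' i : (i < n)%N -> derive1n i (GFI k u) t @[t --> 0^'+] --> a i.
  by move=> im; exact: (ua (Ordinal im)).
have [cg gE] := projector_values n kappa k u a n0 kP du ua'.
set gamma := projector n kappa k u in cg gE.
have uE s : GFI k u s = GFI k gamma s + intn n (GFD n k u) s.
  apply: (GFI_mild n kappa k _ _ u n0 kP cg cD) => r r0.
  by rewrite /gamma /projector subrK.
have hu : has_derive1n n (GFI k u) (GFD n k u) by split.
have hI := has_derive1n_intn n _ cD.
have hg : has_derive1n n (GFI k gamma) (fun=> 0).
  have := has_derive1nD _ _ _ _ _ hu (has_derive1nZ _ (-1) _ _ hI).
  apply: has_derive1n_ext => s s0; first by rewrite uE mulN1r addrK.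
  by rewrite mulN1r subrr.
have gker : GFD_ker n k gamma.
  split; last exact: hg.2.
  split; [exact: cg|exact: hg.1|].
  by apply: Cm1_ext (Cm1_cst 0) => s s0; rewrite [RHS](hg.2 s s0).
have [[dy eqy Fy] _] := ivp_projector_solution n kappa k lambda f gamma n0 kP cf gker.
set y := (fun t => y_f _ _ _ _ + y_iv _ _ _ _) in dy eqy Fy.
have [cy _ _] := dy.
apply: (IVP_values_ext n k lambda f _ y).
  by move=> t t0; rewrite /y (y_iv_valuesE n kappa k lambda a gamma).
split=> // i.
have cp : Cm1 (fun s => f s + lambda * y s) by apply: Cm1D => //; exact: Cm1Z.
have yE := GFI_mild n kappa k _ _ y n0 kP cg cp
  ((projector_mild n kappa k f lambda gamma y eqy).2 Fy).
(* k * y and k * u differ by the remainders, whose derivatives vanish at 0 *)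
have hd : derive1n i (GFI k u) t - derive1n i (intn n (GFD n k u)) t +
    derive1n i (intn n (fun s => f s + lambda * y s)) t @[t --> 0^'+] --> a i - 0 + 0.
  apply: cvgD; first apply: cvgB.
  - exact: (ua i).
  - exact: (derive1n_intn_cvg0 n i _ cD (ltn_ord i)).
  - exact: (derive1n_intn_cvg0 n i _ cp (ltn_ord i)).
rewrite subr0 addr0 in hd; apply: cvg_trans hd; apply: near_eq_cvg; near=> t.
have t0 : 0 < t by [].
have hi w : Cm1 w -> has_derive1n i (intn n w) (derive1n i (intn n w)).
  by move=> cw; apply: derivable_upto_has (has_derive1n_intn n _ cw).1 (ltnW _).
have hui : has_derive1n i (GFI k u) (derive1n i (GFI k u)).
  exact: derivable_upto_has uD (ltnW _).
have h := has_derive1nD _ _ _ _ _ (has_derive1nD _ _ _ _ _ hui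
  (has_derive1nZ _ (-1) _ _ (hi _ cD))) (hi _ cp).
have := h.2 t t0; rewrite mulN1r => <-; apply: eq_derive1n => // s s0.
by rewrite yE uE mulN1r addrK.
Unshelve. all: by end_near. Qed.

Lemma intn1_cvg0 m : exists L : R, intn m (fun=> 1) t @[t --> 0^'+] --> L.
Proof.
case: m => [|m]; first by exists 1; exact: cvg_cst.
by exists 0; apply: intnS_cvg0; exact: Cm1_cst.
Qed.

(** By induction on m. Let kappa^(m) = c + h_1 * kappa^(m+1). Differentiating the
    induction hypothesis gives c k + k * kappa^(m+1) = h_(n-m-1). If c were not 0,
    this would be a Volterra equation for k with kernel - kappa^(m+1) / c, and its
    solution would have a finite limit at 0. *)
Lemma kernel_derive1n n kappa k m : (0 < n)%N -> kernel_pair n kappa k ->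
  Cm1_order n.-1 kappa -> ~ bounded_near k 0^'+ -> (m <= n.-1)%N ->
  forall t, 0 < t -> laplace_conv k (derive1n m kappa) t = intn (n.-1 - m) (fun=> 1) t.
Proof.
move=> n0 kP ok nb; have [ck /Cm10_Cm1 ck' kk] := kP; have c1 := Cm1_cst (1 : R).
elim: m => [_ t t0|m IH mn t t0].
  by rewrite subn0 convC// kk// -hfun_intn// prednK.
set km := derive1n m kappa; set km1 := derive1n m.+1 kappa.
have ckm : Cm1 km by exact: Cm1_order_derive1n ok (ltnW mn).
have ckm1 : Cm1 km1 by exact: Cm1_order_derive1n ok mn.
have [_ dk _] := ok.
have dkm (s : R) : 0 < s -> is_derive s 1 km (km1 s).
  move=> s0; apply: DeriveDef; first exact: dk.
  by rewrite /km1 derive1nS derive1E.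
have [c kmE] := antiderivative_antider _ _ ckm1 dkm.
set j := (n.-1 - m.+1)%N.
have jE : (n.-1 - m = j.+1)%N by rewrite /j subnSK.
have ckk1 := Cm1_conv _ _ ck' ckm1.
have E s : 0 < s ->
    c * antider k s + antider (laplace_conv k km1) s = intn j.+1 (fun=> 1) s.
  move=> s0; rewrite -jE -(IH (ltnW mn) s s0) -/km -conv_antider// -(conv_cst1 _ ck').
  rewrite -(convZr _ _ _ _ ck' c1) -convDr//; [|exact: Cm1Z|exact: Cm1_antider].
  by apply: eq_conv => // r r0; rewrite kmE// mulr1.
have D1 : has_derive1n 1 (fun s => c * antider k s + antider (laplace_conv k km1) s)
    (fun s => c * k s + laplace_conv k km1 s).
  apply: has_derive1nD; first exact/has_derive1nZ/(has_derive1n_intn 1).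
  exact: (has_derive1n_intn 1).
have D2 := has_derive1n_intnD 1 j _ c1.
have key := has_derive1n_unique _ _ _ _ _ E D1 D2.
have [c0|c0] := eqVneq c 0; first by rewrite -key// c0 mul0r add0r.
(* c k + k * kappa^(m+1) = h_(j+1), solved for k *)
exfalso; apply: nb.
pose g s := c^-1 * intn j (fun=> 1) s.
have cg : Cm1 g by apply: Cm1Z; exact: Cm1_intn.
have kE s : 0 < s -> k s = g s + - c^-1 * laplace_conv km1 k s.
  by move=> s0; rewrite /g -key// mulrDr mulrA mulVf// mul1r convC// mulNr addrK.
have kE2 := volterra_unique km1 (- c^-1) g k ckm1 cg ck' kE.
set l := conv_series km1 (- c^-1) in kE2.
have cl : Cm1 l by exact: Cm1_conv_series.
have [L HL] := intn1_cvg0 j.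
have glE s : laplace_conv g l s = c^-1 * intn j.+1 l s.
  have ci := Cm1_intn j _ c1.
  rewrite (convZl _ _ _ _ ci cl) (convC _ _ _ ci cl) conv_intn// (conv_cst1 _ cl).
  by rewrite /intn -iterSr.
apply: (@cvg_bounded _ _ _ _ _ _ (c^-1 * L + - c^-1 * (c^-1 * 0))).
have h : g s + - c^-1 * (c^-1 * intn j.+1 l s) @[s --> 0^'+] -->
    c^-1 * L + - c^-1 * (c^-1 * 0).
  apply: cvgD; first by apply: cvgM; [exact: cvg_cst|exact: HL].
  apply: cvgM; first exact: cvg_cst.
  by apply: cvgM; [exact: cvg_cst|exact: intnS_cvg0].
apply: cvg_trans h; apply: near_eq_cvg; near=> s.
by rewrite kE2// glE.
Unshelve. all: by end_near. Qed.

Lemma derive1n_intn1 i j :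
  let q : R -> R := intn i (fun=> 1) in
  has_derive1n j q (derive1n j q) /\
  ((i < j)%N -> forall t, 0 < t -> derive1n j q t = 0) /\
  derive1n j q t @[t --> 0^'+] --> ((i == j)%:R : R).
Proof.
have c1 := Cm1_cst (1 : R); move=> q.
have h1 : has_derive1n i.+1 q (fun=> 0).
  rewrite -addn1; apply: has_derive1n_trans (has_derive1n_intn i _ c1) _.
  by apply: has_derive1nS (has_derive1n0 _) => t t0; exact: is_derive_cst.
have h : has_derive1n j q (fun t => if (j <= i)%N then intn (i - j) (fun=> 1) t else 0).
  case: leqP => ij; first by have := has_derive1n_intnD j (i - j) _ c1; rewrite subnKC.
  by rewrite -(subnKC ij); apply: has_derive1n_trans h1 (has_derive1n_cst0 _).
split; first by apply: (has_derive1n_ext j q q _ _ _ _ h) => // t t0; rewrite h.2.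
split; first by move=> ij t t0; rewrite h.2// leqNgt ij.
suff lim : (if (j <= i)%N then intn (i - j) (fun=> 1) t else 0) @[t --> 0^'+] -->
    ((i == j)%:R : R).
  by apply: cvg_trans lim; apply: near_eq_cvg; near=> t; rewrite h.2.
have [ij|ij] := leqP j i; last by rewrite ltn_eqF//; exact: cvg_cst.
have [->|nij] := eqVneq i j; first by rewrite subnn; exact: cvg_cst.
have lt : (j < i)%N by rewrite ltn_neqAle eq_sym nij.
by rewrite -(subnSK lt); exact: intnS_cvg0.
Unshelve. all: by end_near. Qed.

(** By [kernel_derive1n] the function gamma = sum_i a_i kappa^(n-1-i) satisfies
    k * gamma = sum_i a_i h_(i+1). *)
Lemma unbounded_attainable n kappa k (a : nat -> R) : (0 < n)%N -> kernel_pair n kappa k ->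
  Cm1_order n.-1 kappa -> ~ bounded_near k 0^'+ -> attainable k (fun i : 'I_n => a i).
Proof.
move=> n0 kP ok nb; have [ck /Cm10_Cm1 ck' kk] := kP; have c1 := Cm1_cst (1 : R).
pose gamma t := \sum_(i < n) a i * derive1n (n.-1 - i) kappa t.
have ci (i : nat) : Cm1 (derive1n (n.-1 - i) kappa).
  exact: Cm1_order_derive1n ok (leq_subr _ _).
have cg : Cm1 gamma by apply: Cm1_sum => i _; exact: Cm1Z.
have gE t : 0 < t -> GFI k gamma t = \sum_(i < n) a i * intn i (fun=> 1) t.
  move=> t0; rewrite /GFI /gamma.
  rewrite (conv_sumr k n (fun i t => a i * derive1n (n.-1 - i) kappa t) t ck').
    apply: eq_bigr => i _; rewrite (convZr _ _ _ _ ck' (ci i)).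
    rewrite (kernel_derive1n n kappa k) ?leq_subr// subKn//.
    by rewrite -ltnS prednK.
  by move=> i _; exact: Cm1Z.
have hsum j : (j <= n)%N -> has_derive1n j (GFI k gamma)
    (fun t => \sum_(i < n) a i * derive1n j (intn i (fun=> 1)) t).
  move=> jn; apply: (has_derive1n_ext j
    (fun t => \sum_(i < n) a i * intn i (fun=> 1) t) _ _ _ _ (fun _ _ => erefl)).
    by move=> t t0; rewrite gE.
  apply: (has_derive1n_sum j n (fun i t => a i * intn i (fun=> 1) t)
    (fun i t => a i * derive1n j (intn i (fun=> 1)) t)) => i im.
  by apply: has_derive1nZ; have [] := derive1n_intn1 i j.
exists gamma.
  have hn := hsum n (leqnn n); split; [exact: cg|exact: hn.1|].
  apply: Cm1_ext (Cm1_cst 0) => t t0; rewrite [RHS](hn.2 t t0) big1// => i _.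
  by rewrite (derive1n_intn1 i n).2.1 ?ltn_ord// mulr0.
move=> j; have h : \sum_(i < n) a i * derive1n j (intn i (fun=> 1)) t @[t --> 0^'+] -->
    \sum_(i < n) a i * (i == j :> nat)%:R.
  apply: cvg_big => [|i _]; first exact: add_continuous.
  apply: cvgM; first exact: cvg_cst.
  by have [_ [_ ]] := derive1n_intn1 i j.
rewrite (bigD1 j)//= eqxx mulr1 big1 ?addr0 in h; last first.
  by move=> i /negbTE ij; rewrite -val_eqE /= in ij; rewrite ij mulr0.
apply: cvg_trans h; apply: near_eq_cvg; near=> t.
by rewrite (hsum j (ltnW (ltn_ord j))).2.
Unshelve. all: by end_near. Qed.

End InitialValueProblems.

Theorem theorem4p1 (R : realType) (n : nat) (n_gt0 : (0 < n)%N)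
    (kappa k : R -> R) (kappa_k : kernel_pair n kappa k)
    (kappa_reg : Cm1_order n.-1 kappa)
    (f : R -> R) (f_Cm1 : Cm1 f) (lambda : R)
    (gamma0 : R -> R) (gamma0_ker : GFD_ker n k gamma0) :
  (* initial condition F y = gamma0 *)
  is_unique_solution (IVP_projector n kappa k lambda f gamma0)
    (fun t => y_f kappa lambda f t + y_iv kappa lambda gamma0 t) /\
  is_unique_solution (IVP_projector n kappa k lambda f (fun=> 0))
    (y_f kappa lambda f) /\
  is_unique_solution (IVP_projector n kappa k lambda (fun=> 0) gamma0)
    (y_iv kappa lambda gamma0) /\
  (* initial values a_i *)
  derivable_upto n.-1 (conv_series kappa lambda) /\
  (forall (a : 'I_n -> R) (y : R -> R), IVP_values k lambda f a y ->
    forall t, 0 < t ->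
      y t = y_f kappa lambda f t + y_iv_values kappa lambda a t) /\
  (forall a : 'I_n -> R, ~ bounded_near k 0^'+ \/ attainable k a ->
    is_unique_solution (IVP_values k lambda f a)
      (fun t => y_f kappa lambda f t + y_iv_values kappa lambda a t) /\
    is_unique_solution (IVP_values k lambda (fun=> 0) a)
      (y_iv_values kappa lambda a)) /\
  is_unique_solution (IVP_values k lambda f (fun _ : 'I_n => 0))
    (y_f kappa lambda f).
Proof.
have [kappa_Cm1 k_Cm10 _] := kappa_k; have [[gamma0_Cm1 _ _] _] := gamma0_ker.
have Cm1_0 := Cm1_cst (0 : R).
have ker0 : GFD_ker n k (fun=> 0) := GFD_ker0 n k k_Cm10.
have y_f0 t : y_f kappa lambda (fun=> 0) t = 0.
  rewrite /y_f convC//; last exact: Cm1_conv_series.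
  by apply: laplace_conv0r.
have y_iv0 t : y_iv kappa lambda (fun=> 0) t = 0.
  by rewrite /y_iv add0r -/(y_f kappa lambda (fun=> 0) t) y_f0 mulr0.
(* families over 'I_n are restrictions of families over nat, which the lemmas on
     initial values take, their proofs shifting the index *)
have extend (a : 'I_n -> R) : exists b : nat -> R, a = (fun i : 'I_n => b i).
  exists (fun i => oapp a 0 (insub i)); apply/funext => i.
  by rewrite valK.
have formula (a : 'I_n -> R) (y : R -> R) : IVP_values k lambda f a y ->
    forall t, 0 < t -> y t = y_f kappa lambda f t + y_iv_values kappa lambda a t.
  have [b ->] := extend a.
  exact: (ivp_values_formula n kappa k lambda f b y n_gt0 kappa_k kappa_reg f_Cm1).
have solution (g : R -> R) (a : 'I_n -> R) : Cm1 g -> attainable k a ->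
    is_unique_solution (IVP_values k lambda g a)
      (fun t => y_f kappa lambda g t + y_iv_values kappa lambda a t).
  move=> cg; have [b ->] := extend a.
  exact: (ivp_values_solution n kappa k lambda g b n_gt0 kappa_k kappa_reg cg).
split; [|split; [|split; [|split; [|split; [|split]]]]].
- exact: ivp_projector_solution.
- apply: is_unique_solution_ext
    (ivp_projector_solution n kappa k lambda f (fun=> 0) n_gt0 kappa_k f_Cm1 ker0).
    exact: IVP_projector_ext.
  by move=> t _; rewrite y_iv0 addr0.
- apply: is_unique_solution_ext
    (ivp_projector_solution n kappa k lambda (fun=> 0) gamma0 n_gt0 kappa_k Cm1_0
      gamma0_ker).
    exact: IVP_projector_ext.
  by move=> t _; rewrite y_f0 add0r.
- exact: derivable_upto_conv_series.
- exact: formula.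
- move=> a a_ok; have att : attainable k a.
    case: a_ok => // nb; have [b ->] := extend a.
    exact: (unbounded_attainable n kappa k b n_gt0 kappa_k kappa_reg nb).
  split; first exact: solution.
  apply: is_unique_solution_ext (solution _ a Cm1_0 att).
    exact: IVP_values_ext.
  by move=> t _; rewrite y_f0 add0r.
- have att : attainable k (fun _ : 'I_n => 0).
    exists (fun=> 0); first exact: ker0.1.
    move=> i; have zero t : 0 < t -> derive1n i (GFI k (fun=> 0)) t = 0.
      move=> t0; transitivity (derive1n i (fun=> 0 : R) t).
        by apply: eq_derive1n t0 => s _; exact: laplace_conv0r.
      exact: (has_derive1n_cst0 i).2.
    have h : (fun=> 0 : R) t @[t --> (0 : R)^'+] --> (0 : R) by exact: cvg_cst.
    apply: cvg_trans h; apply: near_eq_cvg; near=> t.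
    by rewrite zero.
  apply: is_unique_solution_ext (solution f _ f_Cm1 att).
    exact: IVP_values_ext.
  move=> t _; rewrite /y_iv_values big1 ?addr0// => i _.
  by rewrite mul0r.
Unshelve. all: by end_near. Qed.
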